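(* Every $0$-map graph has a vertex whose neighborhood is the union of $3$ cliques.
   Context: Graphs are finite, simple and have at least one vertex. The neighborhood of a vertex $v$ is the set of vertices adjacent to $v$; cliques are sets of pairwise adjacent vertices, and in ''union of $3$ cliques'' the cliques may overlap or be empty (i.e. the neighborhood induces a subgraph with clique cover number at most $3$). $0$-map graph: start with a plane graph $G_0$ (a graph embedded in the sphere, equivalently the plane), with each face (including the outer face) labeled a nation or a lake; $G$ is the graph whose vertices are the nations, two distinct vertices being adjacent iff the corresponding faces share a vertex of $G_0$. Equivalently, there is a planar bipartite graph $H$ with bipartition $(X,Y)$ such that $V(G)=X$ and two distinct vertices of $X$ are adjacent in $G$ iff they have a common neighbor in $Y$. *)

(* Defs.v *)
From HB Require Import structures.
From mathcomp Require Import all_boot all_order all_algebra.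
From mathcomp Require Import all_classical all_reals all_analysis.

Set Implicit Arguments.
Unset Strict Implicit.
Unset Printing Implicit Defensive.

Import Order.TTheory GRing.Theory Num.Theory.
Import numFieldNormedType.Exports.

Local Open Scope ring_scope.

Record sgraph := SGraph {
  vertex :> finType;
  adj : rel vertex;
  adj_sym : symmetric adj;
  adj_irrefl : irreflexive adj }.

Definition neighborhood (G : sgraph) (v : G) : {set G} :=
  finset (fun w => adj v w).

Definition clique (G : sgraph) (A : {set G}) : Prop :=
  {in A &, forall x y, x != y -> adj x y}.

Section Bipartite.
Variables (X Y : finType) (B : X -> Y -> bool).

Definition bip_adj : rel (X + Y)%type := fun a b =>
  match a, b with
  | inl x, inr y | inr y, inl x => B x y
  | _, _ => false
  end.

Lemma bip_adj_sym : symmetric bip_adj.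
Proof. by move=> [x|y] [x'|y']. Qed.

Lemma bip_adj_irrefl : irreflexive bip_adj.
Proof. by move=> [x|y]. Qed.

(* Any simple bipartite graph with bipartition (X, Y) is of this form. *)
Definition bipartite_graph : sgraph := SGraph bip_adj_sym bip_adj_irrefl.
End Bipartite.

Definition simple_arc (R : realType) (a b : R * R) (A : set (R * R)) : Prop :=
  exists g : R -> R * R,
    [/\ {within `[0, 1], continuous g}%classic,
        set_inj `[0, 1]%classic g,
        g 0 = a, g 1 = b & (g @` `[0, 1])%classic = A].

(* A drawing without crossings: [p u] is the point representing the vertex u
   and [arc u v] the closed arc (endpoints included) representing the edge uv.
   By the fourth condition no vertex lies in the interior of an edge, so the
   last one says that distinct edges meet at most in common endpoints. The
   values of [arc] on non-adjacent pairs are irrelevant. *)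
Definition plane_drawing (R : realType) (G : sgraph)
    (p : G -> R * R) (arc : G -> G -> set (R * R)) : Prop :=
  [/\ injective p,
      forall u v, adj u v -> simple_arc (p u) (p v) (arc u v),
      forall u v, adj u v -> arc u v = arc v u,
      forall u v w, adj u v -> arc u v (p w) -> w = u \/ w = v
    & forall u v u' v', adj u v -> adj u' v' ->
        (u', v') <> (u, v) -> (u', v') <> (v, u) ->
        (arc u v `&` arc u' v' `<=` range p)%classic].

Definition planar (R : realType) (G : sgraph) : Prop :=
  exists (p : G -> R * R) (arc : G -> G -> set (R * R)), plane_drawing p arc.

(* 0-map graphs as half-squares of planar bipartite graphs. A point y of Y
   represents a vertex of the underlying plane graph, and [B x y] says that y
   lies on the boundary of the nation x. *)
Definition zero_map_graph (R : realType) (G : sgraph) : Prop :=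
  exists (Y : finType) (B : G -> Y -> bool),
    planar R (bipartite_graph B) /\
    forall x x' : G, x != x' ->
      (adj x x' <-> exists y : Y, B x y /\ B x' y).

(* Main.v *)
Require Import Defs.
From mathcomp Require Import all_boot all_order all_algebra.
From mathcomp Require Import all_classical all_reals all_analysis.
From mathcomp Require Import zify lra.

(* Faces are handled algebraically, as in MacLane's planarity criterion: the
   cycle space of a planar graph is the cut space of a dual graph, and this
   property passes to minors. A topologically planar graph is a minor of a fine
   square grid, for which the dual is explicit.

   Among the planar bipartite graphs H on (X, Y) with half-square G, take one
   minimizing the sum of the squared degrees of the vertices of Y. Then no
   vertex of Y has degree 1, and vertices of Y on a 4-cycle have degree at least 4: one
   of degree 2 could be deleted, and one of degree 3 could be split into two
   vertices of degree 2. If no neighborhood in G is a union of 3 cliques, all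
   vertices of X have degree at least 4, and discharging contradicts Euler's
   formula. Only faces of length 4 and 6 have negative charge. Those of length 4
   are paid for by Y. A face of length 6 has its remaining deficit paid by its
   good corners, i.e. vertices x whose two neighbors y, y' on the face have
   neighborhoods that together form a clique; x of degree 4 has no good corner,
   and x of degree 5 has at most three. *)

Set Implicit Arguments.
Unset Strict Implicit.
Unset Printing Implicit Defensive.

(** * Cycle spaces and abstract duals *)

Section CycleSpace.

Definition boundary (P E : finType) (s t : E -> P) (z : E -> bool) (p : P) :=
  \big[addb/false]_e (z e && ((s e == p) (+) (t e == p))).

Definition coboundary (E Q : Type) (l r : E -> Q) (w : Q -> bool) (e : E) :=
  w (l e) (+) w (r e).

Definition dual (E : Type) (Z : (E -> bool) -> Prop) :=
  exists (Q : finType) (l r : E -> Q),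
    forall z, Z z <-> exists w, z =1 coboundary l r w.

Lemma xor_pred1 (I : finType) (F : I -> bool) (a : I) :
  \big[addb/false]_i (F i && (i == a)) = F a.
Proof.
rewrite (bigD1 a) //= eqxx andbT big1 ?addbF // => i /negPf ->.
by rewrite andbF.
Qed.

Lemma boundaryD (P E : finType) (s t : E -> P) (z z' : E -> bool) p :
  boundary s t (fun e => z e (+) z' e) p =
  boundary s t z p (+) boundary s t z' p.
Proof.
by rewrite /boundary -big_split /=; apply: eq_bigr => e _; rewrite andb_addl.
Qed.

Lemma boundary0 (P E : finType) (s t : E -> P) p :
  boundary s t (fun=> false) p = false.
Proof. by rewrite /boundary big1. Qed.

Lemma boundary_sum (P E I : finType) (s t : E -> P) (z : I -> E -> bool) p :
  boundary s t (fun e => \big[addb/false]_i z i e) p =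
  \big[addb/false]_i boundary s t (z i) p.
Proof.
rewrite /boundary exchange_big /=; apply: eq_bigr => e _.
by rewrite big_distrl.
Qed.

Lemma boundary_scale (P E : finType) (s t : E -> P) (c : bool) (z : E -> bool) p :
  boundary s t (fun e => c && z e) p = c && boundary s t z p.
Proof. by case: c => //=; rewrite boundary0. Qed.

Lemma boundary1 (P E : finType) (s t : E -> P) (a : E) p :
  boundary s t (pred1 a) p = (s a == p) (+) (t a == p).
Proof.
rewrite /boundary -[RHS](xor_pred1 (fun e => (s e == p) (+) (t e == p)) a).
by apply: eq_bigr => e _; rewrite andbC.
Qed.

(* Deleting the edges in [D] from a graph contracts them in its dual, while
   contracting the edges outside the range of [iota] just forgets them. *)
Lemma dual_minor (E : finType) (E' : Type) (Q : finType) (l r : E -> Q)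
    (Z : (E -> bool) -> Prop) (D : pred E) (iota : E' -> option E)
    (Z' : (E' -> bool) -> Prop) :
  (forall w, Z (coboundary l r w)) ->
  (forall z, Z z -> (forall e, D e -> ~~ z e) ->
     exists w, z =1 coboundary l r w) ->
  (forall z', Z' z' <-> exists z, [/\ Z z, forall e, D e -> ~~ z e &
     forall e', z' e' = oapp z false (iota e')]) ->
  dual Z'.
Proof.
move=> ZQ QZ Z'Z.
pose D_adj := [rel a b | [exists e, D e &&
  ((l e == a) && (r e == b) || (l e == b) && (r e == a))]].
have D_sym : connect_sym D_adj.
  apply: sym_connect_sym => a b /=; apply: eq_existsb => e.
  by rewrite orbC.
exists (option Q), (fun e' => omap (fingraph.root D_adj \o l) (iota e')),
  (fun e' => omap (fingraph.root D_adj \o r) (iota e')) => z'; split.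
- case/Z'Z => z [Zz zD z'E]; have [w zE] := QZ z Zz zD.
  exists (oapp w false) => e'; rewrite z'E /coboundary.
  case: (iota e') => [e|] //=; rewrite zE /coboundary.
  have wD a b : connect D_adj a b -> w a = w b.
    case/connectP=> p; elim: p a => [|c p IHp] a /=; first by move=> _ ->.
    case/andP => /existsP[e0 /andP[De0 h]] pc bE.
    rewrite -(IHp c pc bE); move: (zD e0 De0); rewrite zE /coboundary.
    by case/orP: h => /andP[/eqP-> /eqP->]; case: (w a); case: (w c).
  by congr (_ (+) _); apply: wD; rewrite connect_root.
- case=> w z'E; apply/Z'Z.
  exists (coboundary l r (fun q => w (Some (fingraph.root D_adj q)))); split.
  + exact: ZQ.
  + move=> e De; rewrite /coboundary.
    suff -> : fingraph.root D_adj (l e) = fingraph.root D_adj (r e) by rewrite addbb.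
    apply/(fingraph.rootP D_sym)/connect1/existsP; exists e; by rewrite De !eqxx.
  + move=> e'; rewrite z'E /coboundary.
    by case: (iota e') => //=; rewrite addbb.
Qed.

End CycleSpace.

(** * Grids and their minors *)

Section Torus.
Variable n : nat.
Let P : finType := ('I_n.+1 * 'I_n.+1)%type.

Definition torus_src (e : bool * P) : P := e.2.
Definition torus_tgt (e : bool * P) : P :=
  if e.1 then (ordS e.2.1, e.2.2) else (e.2.1, ordS e.2.2).

(* The unit square whose upper right corner is [p] is named by [p]: both edges
   leaving [(i, j)] have the square [(i + 1, j + 1)] on one side, and the other
   side happens to be named by their target. *)
Definition torus_face (e : bool * P) : P := (ordS e.2.1, ordS e.2.2).

Lemma xor_bool_pair (I : finType) (F : bool * I -> bool) :
  \big[addb/false]_e F e =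
  \big[addb/false]_i F (true, i) (+) \big[addb/false]_i F (false, i).
Proof.
transitivity (\big[addb/false]_b \big[addb/false]_i F (b, i)).
  by rewrite pair_bigA; apply: eq_bigr => -[].
by rewrite big_bool.
Qed.

Lemma boundary_torus z i j :
  boundary torus_src torus_tgt z (i, j) =
  (z (true, (i, j)) (+) z (false, (i, j))) (+)
  (z (true, (ord_pred i, j)) (+) z (false, (i, ord_pred j))).
Proof.
rewrite /boundary.
under eq_bigr do rewrite andb_addr.
rewrite big_split /=; congr (_ (+) _).
  by rewrite xor_bool_pair /torus_src /= !xor_pred1.
rewrite xor_bool_pair; congr (_ (+) _).
  rewrite -[RHS](xor_pred1 (fun p => z (true, p))); apply: eq_bigr => -[k m] _.
  by rewrite /torus_tgt /= !xpair_eqE (can2_eq (@ordSK _) (@ord_predK _)).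
rewrite -[RHS](xor_pred1 (fun p => z (false, p))); apply: eq_bigr => -[k m] _.
by rewrite /torus_tgt /= !xpair_eqE (can2_eq (@ordSK _) (@ord_predK _)).
Qed.

Lemma torus_coboundary_cycle w p :
  boundary torus_src torus_tgt (coboundary torus_tgt torus_face w) p = false.
Proof.
case: p => i j; rewrite boundary_torus /coboundary /torus_tgt /torus_face /=.
rewrite !ord_predK.
by case: (w _); case: (w _); case: (w _); case: (w _).
Qed.

Lemma ordS_val (i : 'I_n.+1) : i != ord_max -> ordS i = i.+1 :> nat.
Proof.
move=> iN; rewrite /= modn_small // ltnS ltn_neqAle -ltnS ltn_ord andbT.
by apply: contra iN => /eqP h; apply/eqP/val_inj.
Qed.

Lemma ordS_max : ordS (@ord_max n) = ord0.
Proof. by apply: val_inj; rewrite /= modnn. Qed.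

Lemma ord_pred0 : ord_pred (@ord0 n) = ord_max.
Proof. by rewrite -ordS_max ordSK. Qed.

(* A cycle that does not wrap around is the coboundary of the function counting
   the edges of the cycle crossed by a ray going left from a given square. *)
Lemma torus_cycle_coboundary (z : bool * P -> bool) :
  (forall p, boundary torus_src torus_tgt z p = false) ->
  (forall b i j, (i == ord_max) || (j == ord_max) -> ~~ z (b, (i, j))) ->
  exists w, z =1 coboundary torus_tgt torus_face w.
Proof.
move=> zc zmax.
have {}zc i j : z (true, (i, j)) (+) z (true, (ord_pred i, j)) =
                z (false, (i, j)) (+) z (false, (i, ord_pred j)).
  move: (zc (i, j)); rewrite boundary_torus.
  by case: (z _); case: (z _); case: (z _); case: (z _).
pose W m j := \big[addb/false]_(0 <= k < m) z (false, (inord k, ord_pred j)).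
have WS m j : W m.+1 j = W m j (+) z (false, (inord m, ord_pred j)).
  by rewrite /W big_nat_recr.
have W0 j : W 0 j = false by rewrite /W big_geq.
have Wh m j : (m <= n)%N ->
    W m.+1 j (+) W m.+1 (ordS j) = z (true, (inord m, j)).
  elim: m => [|m IHm] mn; rewrite !WS ordSK.
    rewrite !W0 /= addbC -zc.
    have -> : inord 0 = ord0 :> 'I_n.+1 by apply: val_inj; rewrite /= inordK.
    by rewrite ord_pred0 (negPf (zmax true ord_max j _)) ?eqxx // addbF.
  have := zc (inord m.+1) j.
  have -> : ord_pred (inord m.+1) = inord m :> 'I_n.+1.
    apply: (can_inj (@ordSK _)); rewrite ord_predK; apply: ord_inj.
    rewrite ordS_val ?inordK //; try lia.
    by apply/eqP => /(congr1 val) /=; rewrite inordK; lia.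
  rewrite -(IHm (ltnW mn)).
  rewrite !WS ordSK.
  move: (W m j) (W m (ordS j)) (z (true, (inord m.+1, j)))
    (z (false, (inord m, ord_pred j))) (z (false, (inord m, j)))
    (z (false, (inord m.+1, j))) (z (false, (inord m.+1, ord_pred j))).
  by do 7!case.
have Wrow j : W n.+1 (ordS j) = false.
  have Wpred k : W n.+1 k = W n.+1 (ordS k).
    have := Wh n k (leqnn n); have -> : inord n = @ord_max n.
      by apply: val_inj; rewrite /= inordK.
    rewrite (negPf (zmax true ord_max k _)) ?eqxx //.
    by case: (W _ _); case: (W _ _).
  have {}Wpred k : W n.+1 k = W n.+1 ord0.
    case: k => k; elim: k => [|k IHk] kn; first by congr W; apply: val_inj.
    rewrite -(IHk (ltnW kn)) [in RHS]Wpred; congr W; apply: ord_inj.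
    by rewrite ordS_val //; apply/eqP => /(congr1 val) /=; lia.
  rewrite Wpred /W big1_seq // => k _.
  by rewrite ord_pred0 (negPf (zmax false (inord k) ord_max _)) // eqxx orbT.
exists (fun p : P => W p.1 p.2) => -[b [i j]].
rewrite /coboundary /torus_tgt /torus_face /=.
have [->|iN] := eqVneq i ord_max.
  rewrite (negPf (zmax b ord_max j _)) ?eqxx //.
  case: b => /=; rewrite modnn !W0 // addbF.
  have := Wrow j; rewrite WS ordSK.
  have -> : inord n = @ord_max n by apply: val_inj; rewrite /= inordK.
  by rewrite (negPf (zmax false ord_max j _)) ?eqxx // addbF.
have iS : (i.+1 %% n.+1 = i.+1)%N := ordS_val iN.
case: b => /=; rewrite iS; first by rewrite Wh ?inord_val // -ltnS.
by rewrite WS ordSK inord_val; case: (W _ _); case: (z _).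
Qed.

End Torus.

Section Minor.
Variables (P E V E' : finType) (s t : E -> P) (s' t' : E' -> V).
Variables (B : pred E') (beta : P -> option V).

Definition inner_edge e := (beta (s e) != None) && (beta (s e) == beta (t e)).
Definition inner_adj : rel P := fun p q =>
  [exists e, inner_edge e &&
     ((s e == p) && (t e == q) || (s e == q) && (t e == p))].

Lemma connect_boundary p q : connect inner_adj p q ->
  exists z : E -> bool, (forall e, z e -> inner_edge e) /\
    forall a, boundary s t z a = (p == a) (+) (q == a).
Proof.
case/connectP => c; elim: c p => [|p' c IHc] p /=.
  move=> _ ->; exists (fun=> false); split=> // a.
  by rewrite boundary0 addbb.
case/andP => /existsP[e /andP[ie he]] /IHc{}IHc /IHc[z [zi zb]].
exists (fun e' => pred1 e e' (+) z e'); split.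
  by move=> e' /=; have [->|_ /zi] := eqVneq e' e.
move=> a; rewrite boundaryD boundary1 zb.
by case/orP: he => /andP[/eqP-> /eqP->]; case: (p == a); case: (p' == a); case: (q == a).
Qed.

Variable base : V -> P.
Hypothesis base_conn :
  forall p u, beta p = Some u -> connect inner_adj p (base u).

Lemma fill_boundary (T : P -> bool) :
  (forall p, T p -> beta p != None) ->
  (forall u, \big[addb/false]_p (T p && (beta p == Some u)) = false) ->
  exists z : E -> bool, (forall e, z e -> inner_edge e) /\
    boundary s t z =1 T.
Proof.
move=> Tb Tu.
pose good p (z : E -> bool) := (forall e, z e -> inner_edge e) /\
  forall a, boundary s t z a =
    T p && ((p == a) (+) (omap base (beta p) == Some a)).
have /choice[z zP] p : exists z, good p z.
  case Tp: (T p); last first.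
    by exists (fun=> false); split=> // a; rewrite boundary0 Tp.
  case bp: (beta p) (Tb p Tp) => [u|] // _.
  have [z [zi zb]] := connect_boundary (base_conn bp).
  by exists z; split=> // a; rewrite Tp zb bp.
exists (fun e => \big[addb/false]_p z p e); split.
  move=> e; apply: contraTT => ie; rewrite big1 // => p _.
  by apply/negbTE; apply: contra ie => /(zP p).1.
move=> a; rewrite boundary_sum.
under eq_bigr do rewrite (zP _).2 andb_addr.
rewrite big_split /= xor_pred1.
suff -> : \big[addb/false]_p (T p && (omap base (beta p) == Some a)) = false.
  by rewrite addbF.
transitivity (\big[addb/false]_p \big[addb/false]_u
                (T p && (beta p == Some u) && (base u == a))).
  apply: eq_bigr => p _; case: (beta p) => [v|] /=; last first.
    by rewrite big1 ?andbF // => u _; rewrite andbF.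
  rewrite -[LHS](xor_pred1 (fun u => T p && (Some (base u) == Some a))).
  apply: eq_bigr => u _; rewrite -!andbA; congr (_ && _).
  by rewrite andbC [u == v]eq_sym.
rewrite exchange_big big1 //= => u _.
by rewrite -big_distrl /= Tu.
Qed.

Variable eps : E' -> E.
Hypothesis eps_inj : {in B &, injective eps}.
Hypothesis eps_beta : forall e', B e' ->
  (beta (s (eps e')) = Some (s' e') /\ beta (t (eps e')) = Some (t' e')) \/
  (beta (s (eps e')) = Some (t' e') /\ beta (t (eps e')) = Some (s' e')).
Hypothesis no_loop : forall e', s' e' != t' e'.

Let D e := ~~ (inner_edge e || [exists e', B e' && (eps e' == e)]).

Lemma eps_inc e' u : B e' ->
  (beta (s (eps e')) == Some u) (+) (beta (t (eps e')) == Some u) =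
  (s' e' == u) (+) (t' e' == u).
Proof. by case/eps_beta => -[-> ->] //; rewrite addbC. Qed.

Lemma eps_not_inner e' : B e' -> ~~ inner_edge (eps e').
Proof.
move=> Be; rewrite /inner_edge negb_and; apply/orP; right.
have := no_loop e'; apply: contra => /eqP.
by case: (eps_beta Be) => -[-> ->] [->].
Qed.

Lemma boundary_branch (z : E -> bool) u :
  \big[addb/false]_p (boundary s t z p && (beta p == Some u)) =
  \big[addb/false]_e
    (z e && ((beta (s e) == Some u) (+) (beta (t e) == Some u))).
Proof.
rewrite /boundary; under eq_bigr do rewrite big_distrl /=.
rewrite exchange_big /=; apply: eq_bigr => e _.
under eq_bigr do rewrite -andbA.
rewrite -big_distrr /=; congr (_ && _).
under eq_bigr do rewrite andb_addl.
rewrite big_split /=; congr (_ (+) _).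
  rewrite -[RHS](xor_pred1 (fun p => beta p == Some u)); apply: eq_bigr => p _.
  by rewrite andbC [p == _]eq_sym.
rewrite -[RHS](xor_pred1 (fun p => beta p == Some u)); apply: eq_bigr => p _.
by rewrite andbC [p == _]eq_sym.
Qed.

Lemma minor_cycle (z' : E' -> bool) :
  ((forall e', z' e' -> B e') /\ forall u, boundary s' t' z' u = false) <->
  exists z, [/\ forall p, boundary s t z p = false,
    forall e, D e -> ~~ z e &
    forall e', z' e' = oapp z false (if B e' then Some (eps e') else None)].
Proof.
split=> [[z'B z'c]|[z [zc zD z'E]]]; last first.
  split=> [e'|u]; first by rewrite z'E; case: ifP.
  have := boundary_branch z u; rewrite big1; last by move=> p _; rewrite zc.
  move=> /esym zu; rewrite -[RHS]zu /boundary.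
  transitivity (\big[addb/false]_e' \big[addb/false]_e
     ((z' e' && ((s' e' == u) (+) (t' e' == u))) && (e == eps e'))).
    apply: eq_bigr => e' _.
    by rewrite (xor_pred1 (fun=> _)).
  rewrite exchange_big /=; apply: eq_bigr => e _.
  case ze: (z e) => /=; last first.
    rewrite big1 // => e' _; rewrite z'E; case: ifP => //= _.
    by have [<-|_] := eqVneq e (eps e'); rewrite ?ze ?andbF.
  have [ie|nie] := boolP (inner_edge e).
    have /andP[_ /eqP->] := ie.
    rewrite addbb big1 // => e' _; rewrite z'E; case: ifP => //= Be'.
    have [eE|] := eqVneq e (eps e'); last by rewrite andbF.
    by move: ie; rewrite eE (negPf (eps_not_inner Be')).
  have : ~~ D e by apply: contraTN ze => /zD.
  rewrite negbK (negPf nie) /= => /existsP[e0 /andP[Be0 /eqP eE]].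
  rewrite -eE eps_inc //.
  rewrite -[RHS](xor_pred1 (fun e' => (s' e' == u) (+) (t' e' == u)) e0).
  apply: eq_bigr => e' _; rewrite z'E; case: ifP => /= Be'; last first.
    by have [e'E|] := eqVneq e' e0; [move: Be'; rewrite e'E Be0 | rewrite andbF].
  rewrite (inj_in_eq eps_inj) // [e0 == e']eq_sym.
  have [->|] := eqVneq e' e0; last by rewrite !andbF.
  by rewrite eE ze.
pose z0 e := \big[addb/false]_e' (z' e' && pred1 (eps e') e).
have z0E e' : B e' -> z0 (eps e') = z' e'.
  move=> Be'; rewrite /z0 -[RHS](xor_pred1 z'); apply: eq_bigr => e1 _ /=.
  case z1: (z' e1) => //=.
  by rewrite (inj_in_eq eps_inj) ?[e1 == e']eq_sym //; apply: z'B.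
have z0b : boundary s t z0 =1 fun p => \big[addb/false]_e'
    (z' e' && ((s (eps e') == p) (+) (t (eps e') == p))).
  move=> p; rewrite boundary_sum; apply: eq_bigr => e' _.
  by rewrite boundary_scale boundary1.
have [] := @fill_boundary (boundary s t z0).
- move=> p; rewrite z0b; apply: contraTN => /eqP bp.
  rewrite big1 // => e' _; case z'e: (z' e') => //=.
  have := eps_beta (z'B _ z'e); have [|_] := eqVneq (s (eps e')) p.
    by move=> ->; rewrite bp => -[] [].
  have [|_] := eqVneq (t (eps e')) p; last by [].
  by move=> ->; rewrite bp => -[] [].
- move=> u; rewrite boundary_branch.
  transitivity (\big[addb/false]_e' \big[addb/false]_e
     ((z' e' && ((beta (s e) == Some u) (+) (beta (t e) == Some u)))
      && (e == eps e'))).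
    rewrite exchange_big /=; apply: eq_bigr => e _.
    rewrite /z0 big_distrl /=; apply: eq_bigr => e' _ /=.
    by rewrite -!andbA; congr (_ && _); rewrite andbC.
  rewrite -[RHS](z'c u); apply: eq_bigr => e' _; rewrite xor_pred1.
  by case z'e: (z' e') => //=; rewrite eps_inc //; apply: z'B.
move=> z1 [z1i z1b]; exists (fun e => z0 e (+) z1 e); split.
- by move=> p; rewrite boundaryD z1b addbb.
- move=> e; rewrite /D negb_or => /andP[nie /existsPn ne].
  rewrite (contraNF (z1i e) nie) addbF /z0 big1 // => e' _ /=.
  case z'e: (z' e') => //=; apply/negbTE; have := ne e'.
  by rewrite (z'B _ z'e) /= eq_sym.
- move=> e'; case: ifP => [Be'|/negP Be'] /=; last by apply/negP => /z'B.
  by rewrite z0E // (contraNF (z1i _) (eps_not_inner Be')) addbF.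
Qed.

End Minor.

(** * Bipartite graphs *)

Section Bipartite.
Variables (X Y : finType).

Definition even_in (B : X -> Y -> bool) (z : X * Y -> bool) :=
  (forall e, z e -> B e.1 e.2) /\
  (forall u : X + Y, boundary (fun e : X * Y => inl e.1) (fun e => inr e.2) z u
     = false).

Lemma xor_pair (F : X * Y -> bool) :
  \big[addb/false]_e F e = \big[addb/false]_x \big[addb/false]_y F (x, y).
Proof. by rewrite pair_bigA; apply: eq_bigr => -[]. Qed.

Lemma even_inP B z : even_in B z <->
  [/\ forall x y, z (x, y) -> B x y,
      forall x, \big[addb/false]_y z (x, y) = false
    & forall y, \big[addb/false]_x z (x, y) = false].
Proof.
have bx x : boundary (fun e : X * Y => inl e.1 : X + Y) (fun e => inr e.2) z
    (inl x) = \big[addb/false]_y z (x, y).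
  rewrite /boundary xor_pair.
  rewrite exchange_big /=; apply: eq_bigr => y _.
  rewrite -[RHS](xor_pred1 (fun x => z (x, y))); apply: eq_bigr => x' _.
  by rewrite addbF.
have b_y y : boundary (fun e : X * Y => inl e.1 : X + Y) (fun e => inr e.2) z
    (inr y) = \big[addb/false]_x z (x, y).
  rewrite /boundary xor_pair.
  apply: eq_bigr => x _.
  by rewrite -[RHS](xor_pred1 (fun y => z (x, y))); apply: eq_bigr.
split=> [[zB zb]|[zB zx zy]].
  split=> [x y /zB //|x|y]; first by rewrite -bx zb.
  by rewrite -b_y zb.
split=> [[x y] /zB //|[x|y]]; first by rewrite bx.
by rewrite b_y.
Qed.

Definition map_dual B := dual (even_in B).

Lemma map_dual_sub (B B' : X -> Y -> bool) :
  (forall x y, B' x y -> B x y) -> map_dual B -> map_dual B'.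
Proof.
move=> sub [Q [l [r lr]]].
apply: (dual_minor (Z := even_in B) (D := fun e => ~~ B' e.1 e.2)
  (iota := Some)) => [w|z|z'].
- by apply/lr; exists w.
- by move=> /lr.
- split=> [[zB zb]|[z [[zB zb] zD zE]]].
    exists z'; split=> // [|e]; first by split=> // e /zB /sub.
    by apply: contra => /zB.
  have {zE}-> : z' = z by apply/funext.
  split=> // e ze; apply: contraTT ze; exact: zD.
Qed.

End Bipartite.

(* A vertex [y] adjacent to exactly [x], [x'] and [w] is replaced by a vertex
   [Some y] adjacent to [x] and [w] and a vertex [None] adjacent to [x'] and
   [w]. *)
Section Split.
Variables (X Y : finType) (B : X -> Y -> bool) (y : Y) (x x' w : X).
Hypotheses (xx' : x != x') (xw : x != w) (x'w : x' != w).
Hypothesis By : forall v, B v y = [|| v == x, v == x' | v == w].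

Definition split_rel (v : X) (u : option Y) : bool :=
  match u with
  | Some u => if u == y then (v == x) || (v == w) else B v u
  | None => (v == x') || (v == w)
  end.

Lemma xor_option (F : option Y -> bool) :
  \big[addb/false]_u F u = F None (+) \big[addb/false]_u F (Some u).
Proof.
rewrite (bigD1 None) //=; congr (_ (+) _).
rewrite (reindex_omap Some id) /=; last by case.
by apply: eq_bigl => u; rewrite eqxx.
Qed.

Lemma xor_two (F : X -> bool) a b : a != b ->
  (forall v, F v -> (v == a) || (v == b)) ->
  \big[addb/false]_v F v = F a (+) F b.
Proof.
move=> ab Fab; rewrite (bigD1 a) //= (bigD1 b) 1?eq_sym //=.
rewrite big1 ?addbF // => v /andP[/negPf va /negPf vb].
by apply/negP => /Fab; rewrite va vb.
Qed.

Lemma xor_three (F : X -> bool) :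
  (forall v, F v -> [|| v == x, v == x' | v == w]) ->
  \big[addb/false]_v F v = F x (+) F x' (+) F w.
Proof.
move=> Fx; rewrite (bigD1 x) //= (bigD1 x') 1?eq_sym //= (bigD1 w) /=.
  rewrite big1 ?addbF ?addbA // => v /andP[/andP[/negPf vx /negPf vx'] /negPf vw].
  by apply/negP => /Fx; rewrite vx vx' vw.
by rewrite ![w == _]eq_sym xw x'w.
Qed.

Lemma map_dual_split : map_dual B -> map_dual split_rel.
Proof.
move=> [Q [l [r lr]]].
pose iota (e : X * option Y) : option (X * Y) :=
  match e.2 with
  | Some u => if u == y then
                if (e.1 == x) || (e.1 == w) then Some (x, y) else None
              else Some (e.1, u)
  | None => if (e.1 == x') || (e.1 == w) then Some (x', y) else None
  end.
apply: (dual_minor (Z := even_in B) (D := pred0) (iota := iota)) => [f|z|z'].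
- by apply/lr; exists f.
- by move=> /lr.
have x'x : x' != x by rewrite eq_sym.
have wx : w != x by rewrite eq_sym.
have wx' : w != x' by rewrite eq_sym.
pose neqs := (negPf xx', negPf xw, negPf x'w, negPf x'x, negPf wx, negPf wx').
split.
- move=> /even_inP[zB zx zy].
  have zN v : z' (v, None) -> (v == x') || (v == w) by move/zB.
  have zS v : z' (v, Some y) -> (v == x) || (v == w).
    by move/zB; rewrite /= eqxx.
  have zNw : z' (x', None) = z' (w, None).
    have := zy None; rewrite (xor_two x'w zN).
    by case: (z' _); case: (z' _).
  have zSw : z' (x, Some y) = z' (w, Some y).
    have := zy (Some y); rewrite (xor_two xw zS).
    by case: (z' _); case: (z' _).
  pose z (e : X * Y) := z' (e.1, Some e.2) (+) ((e.2 == y) && z' (e.1, None)).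
  exists z; split=> //.
    apply/even_inP; split=> [v u|v|u].
    + rewrite /z /=; have [->|uy] := eqVneq u y.
        rewrite By; case zvS: (z' (v, Some y)) => /=.
          by case/orP: (zS v zvS) => ->; rewrite ?orbT.
        by move=> /zN /orP[] ->; rewrite ?orbT.
      by rewrite addbF => /zB /=; rewrite (negPf uy).
    + rewrite /z big_split /= -[RHS](zx v) xor_option addbC; congr (_ (+) _).
      rewrite -[RHS](xor_pred1 (fun=> z' (v, None)) y).
      by apply: eq_bigr => u _; rewrite andbC.
    + rewrite /z big_split /= zy /=; case: eqP => _ /=; last by rewrite big1.
      exact: zy.
  case=> v [u|] /=; rewrite /iota /=; last first.
    case: ifP => [|h]; last by apply/negP => /zN; rewrite h.
    rewrite /z /= eqxx /= => h.
    have -> : z' (x', Some y) = false.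
      by apply/negP => /zS; rewrite !neqs.
    by case/orP: h => /eqP->.
  have [->|uy] := eqVneq u y; last by rewrite /z /= (negPf uy) addbF.
  case: ifP => [|h]; last by apply/negP => /zS; rewrite h.
  rewrite /z /= eqxx /= => h.
  have -> : z' (x, None) = false by apply/negP => /zN; rewrite !neqs.
  by rewrite addbF; case/orP: h => /eqP->.
- case=> z [/even_inP[zB zx zy] _ z'E]; apply/even_inP.
  have zy' : z (x, y) (+) z (x', y) (+) z (w, y) = false.
    by rewrite -(zy y) (xor_three (F := fun v => z (v, y))) // => v /zB; rewrite By.
  split=> [v u|v|u].
  + rewrite z'E /iota /=; case: u => [u|] /=; last by case: ifP.
    by have [_|uy] := eqVneq u y; [case: ifP | move=> /zB].
  + rewrite xor_option -[RHS](zx v) (bigD1 y) //= [RHS](bigD1 y) //= addbA.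
    have -> : \big[addb/false]_(i | i != y) z' (v, Some i) =
              \big[addb/false]_(i | i != y) z (v, i).
      by apply: eq_bigr => u uy; rewrite z'E /iota /= (negPf uy).
    congr (_ (+) _); rewrite !z'E /iota /= eqxx.
    have [->|vx] := eqVneq v x; first by rewrite /= !neqs.
    have [->|vx'] := eqVneq v x'; first by rewrite /= !neqs /= addbF.
    have [->|vw] := eqVneq v w => /=.
      by move: zy'; case: (z _); case: (z _); case: (z _).
    by apply/esym/negP => /zB; rewrite By (negPf vx) (negPf vx') (negPf vw).
  + case: u => [u|]; last first.
      rewrite (xor_two x'w); last by move=> v; rewrite z'E /iota /=; case: ifP.
      by rewrite !z'E /iota /= !eqxx orbT addbb.
    have [->|uy] := eqVneq u y; last first.
      rewrite -[RHS](zy u); apply: eq_bigr => v _.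
      by rewrite z'E /iota /= (negPf uy).
    rewrite (xor_two xw).
      by rewrite !z'E /iota /= !eqxx orbT addbb.
    by move=> v; rewrite z'E /iota /= eqxx; case: ifP.
Qed.

End Split.

(** * Even subgraphs and Euler's inequality *)

Section EvenSubgraph.
Variables (X Y : finType) (B : X -> Y -> bool).

Lemma card_sum (I : finType) (P : pred I) : #|P| = \sum_i P i.
Proof.
rewrite -sum1_card big_mkcond /=; apply: eq_bigr => i _.
by rewrite unfold_in; case: (P i).
Qed.

Lemma uniq_leq_card (I : finType) (P : pred I) (c : seq I) :
  uniq c -> all P c -> (size c <= #|P|)%N.
Proof.
move=> cU /allP cP; rewrite -(card_uniqP cU); apply: subset_leq_card.
by apply/fintype.subsetP => i /cP.
Qed.

Lemma xor_another (I : finType) (F : I -> bool) i :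
  \big[addb/false]_j F j = false -> F i -> exists2 j, j != i & F j.
Proof.
move=> F0 Fi; apply/exists_inP; apply: contraFT F0 => /exists_inPn F1.
rewrite (bigD1 i) //= Fi big1 // => j ji; exact/negbTE/F1.
Qed.

Definition four_cycle (f : X * Y -> bool) x x' y y' :=
  [&& x != x', y != y', f (x, y), f (x, y'), f (x', y) & f (x', y')].

Definition hexagon (f : X * Y -> bool) x0 x1 x2 y0 y1 y2 :=
  [&& uniq [:: x0; x1; x2], uniq [:: y0; y1; y2] &
   all f [:: (x0, y1); (x0, y2); (x1, y0); (x1, y2); (x2, y0); (x2, y1)]].

Lemma even_subgraph_cases f e : even_in B f -> f e ->
  [\/ exists x x' y y', four_cycle f x x' y y',
      exists x0 x1 x2 y0 y1 y2, hexagon f x0 x1 x2 y0 y1 y2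
    | (8 <= #|f|)%N].
Proof.
case: e => x0 y0 /even_inP[_ fx fy] f00.
have [[x [x' [y [y' C4]]]]|/forallNP no4] :=
  pselect (exists x x' y y', four_cycle f x x' y y').
  by constructor 1; exists x, x', y, y'.
have {}no4 x x' y y' : x != x' -> y != y' -> f (x, y) -> f (x, y') ->
    f (x', y) -> f (x', y') -> False.
  move=> h1 h2 h3 h4 h5 h6; apply: (no4 x); exists x', y, y'.
  by rewrite /four_cycle h1 h2 h3 h4 h5 h6.
have [y1 y10 f01] := xor_another (fx x0) f00.
have [x1 x10 f10] := xor_another (fy y0) f00.
have [x2 x20 f21] := xor_another (fy y1) f01.
have [y2 y20 f12] := xor_another (fx x1) f10.
have [y3 y31 f23] := xor_another (fx x2) f21.
have x12 : x1 != x2.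
  by apply/eqP => E; apply: (no4 x0 x1 y0 y1); rewrite 1?eq_sym // E.
have y21 : y2 != y1.
  by apply/eqP => E; apply: (no4 x0 x1 y0 y1); rewrite 1?eq_sym // -E.
have y30 : y3 != y0.
  by apply/eqP => E; apply: (no4 x0 x2 y0 y1); rewrite 1?eq_sym // -E.
have [E|y23] := eqVneq y2 y3.
  constructor 2; exists x0, x1, x2, y2, y1, y0.
  by rewrite /hexagon /= !inE !negb_or f01 f00 f12 f10 E f23 f21
    [x0 == x1]eq_sym [x0 == x2]eq_sym x10 x20 x12 -E y21 y20 y10.
constructor 3.
have [x3 x31 f32] := xor_another (fy y2) f12.
have [x4 x42 f43] := xor_another (fy y3) f23.
apply: (@uniq_leq_card _ f [:: (x0, y0); (x0, y1); (x1, y0); (x2, y1);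
  (x1, y2); (x2, y3); (x3, y2); (x4, y3)]); last first.
  by rewrite /= f00 f01 f10 f21 f12 f23 f32 f43.
rewrite /= !inE !xpair_eqE !negb_or !negb_and.
have neqs := (negPf x10, negPf x20, negPf x12, negPf x31, negPf x42,
  negPf y10, negPf y20, negPf y21, negPf y30, negPf y31, negPf y23).
by rewrite !(eq_sym x0 x1, eq_sym x0 x2, eq_sym x1 x3, eq_sym x2 x4,
  eq_sym y0 y1, eq_sym y0 y2, eq_sym y0 y3, eq_sym y1 y2, eq_sym y1 y3, eq_sym y3 y2,
  neqs, orbT).
Qed.

End EvenSubgraph.

Section Euler.
Variables (X Y Q : finType) (B : X -> Y -> bool) (l r : X * Y -> Q).
Hypothesis lr : forall z, even_in B z <-> exists w, z =1 coboundary l r w.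

Definition face (q : Q) : X * Y -> bool := coboundary l r (pred1 q).

Lemma face_even q : even_in B (face q).
Proof. by apply/lr; exists (pred1 q). Qed.

Lemma sum_face e : (\sum_q face q e <= 2)%N.
Proof.
apply: (@leq_trans (\sum_q ((q == l e) + (q == r e)))%N).
  apply: leq_sum => q _; rewrite /face /coboundary /= ![_ == q]eq_sym.
  by case: (q == l e); case: (q == r e).
by rewrite big_split /= -!card_sum !card1.
Qed.

(* The edge sets with prescribed degree parities form a translate of the cycle
   space, whose elements are coboundaries of sets of nonempty faces. The parity
   at one vertex [x0] is determined by the others. *)
Lemma euler (x0 : X) :
  (#|[pred e | B e.1 e.2]| + 1 <=
   #|X| + #|[pred y | [exists x, B x y]]| +
   #|[pred q | [exists e, face q e]]|)%N.
Proof.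
set E := [pred e | B e.1 e.2]; set Y1 := [pred y | _]; set F := [pred q | _].
pose par (S : {set X * Y}) : {set X} * {set Y} :=
  (finset (fun x => (x != x0) && \big[addb/false]_y ((x, y) \in S)),
   finset (fun y => \big[addb/false]_x ((x, y) \in S))).
pose rep p := odflt finset.set0 [pick S : {set X * Y} | (S \subset E) && (par S == p)].
have repP (S : {set X * Y}) : S \subset E -> rep (par S) \subset E /\ par (rep (par S)) = par S.
  move=> SE; rewrite /rep; case: pickP => [S' /andP[-> /eqP->] //|/(_ S)].
  by rewrite SE eqxx.
have fillP (S : {set X * Y}) : S \subset E -> exists w : {set Q}, (w \subset F) &&
    [forall e, (e \in S) (+) (e \in rep (par S)) ==
               coboundary l r (mem w) e].
  move=> SE; have [RE parR] := repP S SE; set R := rep _ in RE parR *.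
  pose z e := (e \in S) (+) (e \in R).
  have : even_in B z.
    have zy y : \big[addb/false]_x z (x, y) = false.
      move: parR => [_ /setP/(_ y)]; rewrite !inE => parR.
      by rewrite big_split /= parR addbb.
    have zx x : x != x0 -> \big[addb/false]_y z (x, y) = false.
      move: parR => [/setP/(_ x)]; rewrite !inE => parR _ xx0.
      by move: parR; rewrite xx0 big_split /= => ->; rewrite addbb.
    apply/even_inP; split=> // [x y|x].
      rewrite /z; have [/(fintype.subsetP SE)|_] := boolP (_ \in S) => //.
      by have [/(fintype.subsetP RE)|_] := boolP (_ \in R).
    have [->|/zx//] := eqVneq x x0.
    have : \big[addb/false]_x \big[addb/false]_y z (x, y) = false.
      by rewrite exchange_big big1.
    by rewrite (bigD1 x0) //= [X in _ (+) X]big1 ?addbF.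
  case/lr => w zw; exists (finset (fun q => F q && w q)); apply/andP; split.
    by apply/fintype.subsetP => q; rewrite inE => /andP[].
  apply/forallP => e; rewrite -/(z e) zw /coboundary !inE.
  have FE q : [exists e, face q e] = false -> l e = q \/ r e = q -> l e = r e.
    move=> /existsPn/(_ e); rewrite /face /coboundary /= => h.
    by case=> qE; move: h; rewrite qE eqxx; case: eqP.
  apply/eqP; case Fl: [exists e', face (l e) e'] => /=; last first.
    by rewrite -(FE _ Fl (or_introl erefl)) Fl addbb.
  case Fr: [exists e', face (r e) e'] => //=.
  by rewrite (FE _ Fr (or_intror erefl)) Fr in Fl.
pose fill (S : {set X * Y}) := odflt finset.set0 [pick w : {set Q} | (w \subset F) &&
    [forall e, (e \in S) (+) (e \in rep (par S)) ==
               coboundary l r (mem w) e]].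
pose code (S : {set X * Y}) := (par S, fill S).
have codeF (S : {set X * Y}) : S \subset E -> (fill S \subset F) /\
   forall e, (e \in S) = (e \in rep (par S)) (+) coboundary l r (mem (fill S)) e.
  move=> SE; rewrite /fill; case: pickP => [w /andP[-> /forallP h]|h].
    by split=> // e; rewrite -(eqP (h e)); case: (e \in S); case: (e \in rep _).
  by have [w] := fillP S SE; rewrite h.
have code_inj : {in powerset (finset E) &, injective code}.
  move=> S S'; rewrite !inE => /fintype.subsetP SE /fintype.subsetP SE'.
  have {}SE : S \subset E by apply/fintype.subsetP => e /SE; rewrite inE.
  have {}SE' : S' \subset E by apply/fintype.subsetP => e /SE'; rewrite inE.
  case=> p1 p2 p3; apply/setP => e.
  by rewrite (codeF S SE).2 (codeF S' SE').2 p3 /par p1 p2.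
pose cod := finset.setX (finset.setX (powerset [set~ x0]%SET) (powerset (finset Y1)))
  (powerset (finset F)).
have code_cod (S : {set X * Y}) : S \in powerset (finset E) -> code S \in cod.
  rewrite inE => /fintype.subsetP SE.
  have {}SE : S \subset E by apply/fintype.subsetP => e /SE; rewrite inE.
  rewrite !inE -andbA; apply/and3P; split.
  - by apply/fintype.subsetP => x; rewrite !inE => /andP[].
  - apply/fintype.subsetP => y; rewrite !inE; apply: contraTT => /existsPn h.
    rewrite big1 // => x _; apply/negP => /(fintype.subsetP SE).
    exact/negP/h.
  - apply/fintype.subsetP => q /(fintype.subsetP (codeF S SE).1).
    by rewrite inE.
have : (#|powerset (finset E)| <= #|cod|)%N.
  rewrite -(card_in_imset code_inj); apply: subset_leq_card.
  by apply/fintype.subsetP => _ /imsetP[S SE ->]; apply: code_cod.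
rewrite /cod !cardsX !card_powerset -!expnD leq_exp2l // cardsC1.
have cardE (I : finType) (p : pred I) : #|finset p| = #|p|.
  by apply: eq_card => i; rewrite inE.
rewrite !cardE.
rewrite addn1 => /leq_ltn_trans; apply.
by rewrite ltn_add2r ltn_add2r ltn_predL; apply/card_gt0P; exists x0.
Qed.

End Euler.

(** * Discharging *)

Section Discharging.
Variable G : sgraph.

Definition tricovered_vertex := exists (v : G) (A B C : {set G}),
  [/\ clique A, clique B, clique C & neighborhood v = (A :|: B :|: C)%SET].

Variables (Y : finType) (B : G -> Y -> bool).
Hypothesis half_square : forall x x' : G, x != x' ->
  (adj x x' <-> exists y : Y, B x y /\ B x' y).

Definition degX x := #|[pred y | B x y]|.
Definition degY y := #|[pred x | B x y]|.

Definition linked (x : G) (y y' : Y) := forall w w', w != x -> w' != x ->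
  w != w' -> B w y || B w y' -> B w' y || B w' y' -> adj w w'.

Lemma linked_refl x y : linked x y y.
Proof.
move=> w w' _ _ ww'; rewrite !orbb => wy w'y.
by apply/(half_square ww'); exists y.
Qed.

Lemma adj_neq (x w : G) : adj x w -> w != x.
Proof. by apply: contraTneq => ->; rewrite adj_irrefl. Qed.

Lemma cover_tricovered x (c : seq (Y * Y)) : (size c <= 3)%N ->
  (forall p, p \in c -> linked x p.1 p.2) ->
  (forall y, B x y -> exists2 p, p \in c & (y == p.1) || (y == p.2)) ->
  tricovered_vertex.
Proof.
move=> c3 c_link c_cov.
pose K (o : option (Y * Y)) : {set G} := finset (fun w => adj x w &&
  (if o is Some p then B w p.1 || B w p.2 else false)).
have Kc o : (if o is Some p then p \in c else true) -> clique (K o).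
  case: o => [p|] pc w w'; rewrite !inE ?andbF //.
  move=> /andP[/adj_neq wx wp] /andP[/adj_neq w'x w'p] ww'.
  exact: (c_link p pc).
exists x, (K (onth c 0)), (K (onth c 1)), (K (onth c 2)).
have Ko i : clique (K (onth c i)).
  apply: Kc; case E: (onth c i) => [p|] //.
  by apply/onthP; exists i.
split=> //; apply/setP => w; rewrite !inE -!andb_orr.
case xw: (adj x w); last by [].
rewrite andTb; apply/esym.
have xnw : x != w by rewrite eq_sym adj_neq.
have [y [xy wy]] := (half_square xnw).1 xw.
have [p /onthP[i ip] yp] := c_cov y xy.
have wp : B w p.1 || B w p.2.
  by case/orP: yp => /eqP <-; rewrite wy ?orbT.
have : (i < 3)%N.
  rewrite ltnNge; apply/negP => i3; move: ip.
  by rewrite onth_default // (leq_trans c3).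
case: i ip => [|[|[|//]]] -> _; rewrite wp ?orbT //.
Qed.

Lemma matching_tricovered x (m : seq (Y * Y)) :
  (forall p, p \in m -> [/\ linked x p.1 p.2, B x p.1 & B x p.2]) ->
  uniq (unzip1 m ++ unzip2 m) -> (degX x <= 3 + size m)%N ->
  tricovered_vertex.
Proof.
move=> m_link mU dm; set U := unzip1 m ++ unzip2 m in mU.
pose R := [seq y <- enum [pred y | B x y] | y \notin U].
apply: (@cover_tricovered x (m ++ [seq (y, y) | y <- R])).
- have sU : size U = (2 * size m)%N.
    by rewrite size_cat !size_map mul2n addnn.
  have : (size U + size R <= degX x)%N.
    rewrite /degX -size_cat; apply: uniq_leq_card.
      rewrite cat_uniq mU filter_uniq ?enum_uniq // andbT.
      by apply/hasPn => y; rewrite mem_filter => /andP[].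
    rewrite all_cat; apply/andP; split; apply/allP => y.
      by rewrite mem_cat => /orP[] /mapP[p /m_link[_ h1 h2] ->].
    by rewrite mem_filter mem_enum => /andP[].
  rewrite size_cat size_map; lia.
- move=> p; rewrite mem_cat => /orP[/m_link[] //|/mapP[y _ ->]].
  exact: linked_refl.
- move=> y xy; case yU: (y \in U).
    move: yU; rewrite mem_cat => /orP[] /mapP[p pm ->];
      by exists p; rewrite ?mem_cat ?pm // eqxx ?orbT.
  exists (y, y); last by rewrite eqxx.
  rewrite mem_cat; apply/orP; right; apply/mapP; exists y => //.
  by rewrite mem_filter yU mem_enum.
Qed.

Hypothesis degY_neq1 : forall y, degY y != 1%N.
Hypothesis four_cycle_degY : forall x x' y y', x != x' -> y != y' ->
  B x y -> B x' y -> B x y' -> B x' y' -> (4 <= degY y)%N.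
Hypothesis no_tricovered : ~ tricovered_vertex.

(* Charges summing to [24 (E - V - F)]: a face of length [2k] starts with
   [6k - 24], each [x] with [6 deg x - 24], each [y] with [12 deg y - 24]; then
   [y] gives [2 * weight y] to each of its faces and [x] gives 2 to each face
   having a good corner at [x]. *)
Definition weight (y : Y) : nat :=
  if degY y == 2 then 0 else if degY y == 3 then 2 else 3.

Definition good_corner (f : G * Y -> bool) x := `[< exists y y',
  [/\ y != y', f (x, y), f (x, y') & linked x y y'] >].

Lemma degY_cases x y : B x y ->
  [\/ degY y = 2, degY y = 3 | (4 <= degY y)%N].
Proof.
move=> xy; have := degY_neq1 y.
have : (0 < degY y)%N by apply/card_gt0P; exists x.
case: (degY y) => [|[|[|[|d]]]] // _ _.
- by constructor 1.
- by constructor 2.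
- by constructor 3.
Qed.

Lemma degY2 y x x' w : degY y = 2 -> x != x' -> B x y -> B x' y -> B w y ->
  (w == x) || (w == x').
Proof.
move=> d2 xx' xy x'y wy; apply: contraTT isT; rewrite negb_or => /andP[wx wx'].
have : (3 <= degY y)%N.
  apply: (@uniq_leq_card _ _ [:: w; x; x']).
    by rewrite /= !inE negb_or wx wx' xx'.
  by rewrite /= wy xy x'y.
by rewrite d2.
Qed.

Lemma linked_degree2 x x' x'' y y' y'' : degY y = 2 -> degY y' = 2 ->
  x != x' -> x != x'' -> x' != x'' -> B x y -> B x' y -> B x y' -> B x'' y' ->
  B x' y'' -> B x'' y'' -> linked x y y'.
Proof.
move=> d d' xx' xx'' x'x'' xy x'y xy' x''y' x'y'' x''y''.
have a : adj x' x'' by apply/(half_square x'x''); exists y''.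
have side v : v != x -> B v y || B v y' -> (v == x') || (v == x'').
  move=> /negPf vx /orP[/(degY2 d xx' xy x'y)|/(degY2 d' xx'' xy' x''y')];
    by rewrite vx /= => ->; rewrite ?orbT.
move=> w w' wx w'x ww' /(side w wx) h /(side w' w'x) h'.
case/orP: h ww' => /eqP->; case/orP: h' => /eqP->; rewrite ?eqxx //.
by rewrite adj_sym.
Qed.

Lemma face_charge f e : even_in B f -> f e ->
  (24 <= 3 * #|f| + 2 * \sum_(y | [exists x, f (x, y)]) weight y +
    2 * #|good_corner f|)%N.
Proof.
move=> fB fe; have fBB x y : f (x, y) -> B x y by case: fB => + _ => /[apply].
have weight_seq c : uniq c -> all (fun y => [exists x, f (x, y)]) c ->
    (\sum_(y <- c) weight y <= \sum_(y | [exists x, f (x, y)]) weight y)%N.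
  move=> cU /allP cf.
  rewrite big_uniq //= [leqLHS]big_mkcond [leqRHS]big_mkcond /=.
  apply: leq_sum => y _; case: ifP => // /cf /= -> //.
case: (even_subgraph_cases fB fe) => [[x [x' [y [y' /and5P[xx' yy' f1 f2]]]]]|
  [x0 [x1 [x2 [y0 [y1 [y2 /and3P[xU yU]]]]]]]|]; last by lia.
- case/andP => f3 f4.
  have f4card : (4 <= #|f|)%N.
    apply: (@uniq_leq_card _ f [:: (x, y); (x, y'); (x', y); (x', y')]).
      by rewrite /= !inE !xpair_eqE !eqxx (negPf xx') (negPf yy').
    by rewrite /= f1 f2 f3 f4.
  have := weight_seq [:: y; y']; rewrite /= !inE yy' => /(_ isT).
  have -> : [exists x0, f (x0, y)] by apply/existsP; exists x.
  have -> : [exists x0, f (x0, y')] by apply/existsP; exists x.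
  move=> /(_ isT); rewrite !big_cons big_nil.
  have d : (4 <= degY y)%N by apply: (@four_cycle_degY x x' y y'); auto.
  have d' : (4 <= degY y')%N.
    have y'y : y' != y by rewrite eq_sym.
    by apply: (@four_cycle_degY x x' y' y); auto.
  have wE z : (4 <= degY z)%N -> weight z = 3.
    by rewrite /weight; case: (degY z) => [|[|[|[|]]]].
  by rewrite !wE //; lia.
case/and5P=> f01 f02 f10 f12 /and3P[f20 f21 _].
have : (6 <= #|f|)%N.
  apply: (@uniq_leq_card _ f [:: (x0, y1); (x0, y2); (x1, y0); (x1, y2);
    (x2, y0); (x2, y1)]); last by rewrite /= f01 f02 f10 f12 f20 f21.
  move: xU yU; rewrite /= !inE !xpair_eqE !eqxx /= !negb_or !andbT.
  case/andP=> /andP[/negPf x01 /negPf x02] /negPf x12.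
  case/andP=> /andP[/negPf y01 /negPf y02] /negPf y12.
  by rewrite x01 x02 x12 (eq_sym y2 y0) (eq_sym y1 y0) (eq_sym y2 y1) y01 y02 y12.
have := weight_seq [:: y0; y1; y2] yU; rewrite /=.
have -> : [exists x, f (x, y0)] by apply/existsP; exists x1.
have -> : [exists x, f (x, y1)] by apply/existsP; exists x0.
have -> : [exists x, f (x, y2)] by apply/existsP; exists x0.
move=> /(_ isT); rewrite !big_cons big_nil.
move: xU yU; rewrite /= !inE !negb_or !andbT.
case/andP=> /andP[x01 x02] x12 /andP[/andP[y01 y02] y12].
have x10 : x1 != x0 by rewrite eq_sym.
have x20 : x2 != x0 by rewrite eq_sym.
have x21 : x2 != x1 by rewrite eq_sym.
have good0 : degY y1 = 2 -> degY y2 = 2 -> good_corner f x0.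
  move=> d1 d2; apply/asboolP; exists y1, y2; split=> //.
  by apply: (@linked_degree2 x0 x2 x1 _ _ y0); auto.
have good1 : degY y0 = 2 -> degY y2 = 2 -> good_corner f x1.
  move=> d1 d2; apply/asboolP; exists y0, y2; split=> //.
  by apply: (@linked_degree2 x1 x2 x0 _ _ y1); auto.
have good2 : degY y0 = 2 -> degY y1 = 2 -> good_corner f x2.
  move=> d1 d2; apply/asboolP; exists y0, y1; split=> //.
  by apply: (@linked_degree2 x2 x1 x0 _ _ y2); auto.
have g3 c : uniq c -> all (good_corner f) c -> (size c <= #|good_corner f|)%N.
  exact: uniq_leq_card.
have wP x y : B x y -> (weight y = 0 /\ degY y = 2) \/ (2 <= weight y)%N.
  by rewrite /weight => /degY_cases[->|->|]; [left|right|
    case: (degY y) => [|[|[|[|d]]]] // _; right].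
move: (wP _ _ (fBB _ _ f10)) (wP _ _ (fBB _ _ f01)) (wP _ _ (fBB _ _ f02)).
have gall := g3 [:: x0; x1; x2]; move: (g3 [:: x0]) (g3 [:: x1]) (g3 [:: x2]) gall.
rewrite /= !inE negb_or x01 x02 x12 /=.
move: (good_corner f x0) (good_corner f x1) (good_corner f x2) #|good_corner f|
  #|f| (\sum_(y | _) _) good0 good1 good2.
move: (weight y0) (weight y1) (weight y2) => w0 w1 w2.
move=> b0 b1 b2 c n s good0 good1 good2 {g3 wP weight_seq fBB}.
move=> g0 g1 g2 gall [[-> d0]|w0_2] [[-> d1]|w1_2] [[-> d2]|w2_2] sw n6.
- by move: gall; rewrite good0 // good1 // good2 // => /(_ isT isT) c3; clear -sw n6 c3; lia.
- by move: g2; rewrite good2 // => /(_ isT isT) c1; clear -sw n6 c1 w2_2; lia.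
- by move: g1; rewrite good1 // => /(_ isT isT) c1; clear -sw n6 c1 w1_2; lia.
- by clear -sw n6 w1_2 w2_2; lia.
- by move: g0; rewrite good0 // => /(_ isT isT) c1; clear -sw n6 c1 w0_2; lia.
- by clear -sw n6 w0_2 w2_2; lia.
- by clear -sw n6 w0_2 w1_2; lia.
- by clear -sw n6 w0_2 w1_2 w2_2; lia.
Qed.

Lemma degX_ge4 x : (4 <= degX x)%N.
Proof.
rewrite ltnNge; apply/negP => d3; apply: no_tricovered.
by apply: (@matching_tricovered x [::]); rewrite ?addn0.
Qed.

Lemma vertex_charge (Q : finType) (f : Q -> G * Y -> bool) x :
  (forall q, even_in B (f q)) -> (forall e, \sum_q f q e <= 2)%N ->
  (24 + 2 * \sum_q good_corner (f q) x <= 6 * degX x)%N.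
Proof.
move=> fB f2; have d4 := degX_ge4 x.
have fBB q y : f q (x, y) -> B x y by case: (fB q) => + _ => /[apply].
have [d6|] := leqP 6 (degX x).
  suff : (2 * \sum_q good_corner (f q) x <= 2 * degX x)%N by lia.
  rewrite big_distrr /=.
  apply: (@leq_trans (\sum_q \sum_y f q (x, y))%N).
    apply: leq_sum => q _; case gq: (good_corner (f q) x) => //=.
    move/asboolP: gq => [y [y' [yy' fy fy' _]]]; rewrite -card_sum.
    apply: (@uniq_leq_card _ (fun y => f q (x, y)) [:: y; y']).
      by rewrite /= inE yy'.
    by rewrite /= fy fy'.
  rewrite exchange_big /= /degX card_sum big_distrr /=.
  apply: leq_sum => y _; case xy: (B x y) => /=; first exact: f2.
  by rewrite big1 // => q _; apply/eqP; rewrite eqb0; apply/negP => /fBB; rewrite xy.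
rewrite ltnS leq_eqVlt => /orP[/eqP d5|]; last first.
  rewrite ltnS => d4'; have dE : degX x = 4 by lia.
  rewrite dE big1 // => q _; apply/eqP; rewrite eqb0.
  apply/negP => /asboolP[y [y' [yy' fy fy' lyy']]]; apply: no_tricovered.
  apply: (@matching_tricovered x [:: (y, y')]); rewrite ?dE //=.
    by move=> p; rewrite inE => /eqP-> /=; split=> //; [exact: fBB fy|exact: fBB fy'].
  by rewrite inE yy'.
rewrite d5; suff : (\sum_q good_corner (f q) x <= 3)%N by lia.
rewrite -card_sum.
have [/existsP[q0 /asboolP[a [b [ab fa fb lab]]]]|/existsPn no_good] :=
  boolP [exists q, good_corner (f q) x]; last first.
  by rewrite eq_card0 // => q; apply/negbTE/no_good.
have cardf y : (#|[pred q | f q (x, y)]| <= 2)%N by rewrite card_sum; apply: f2.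
apply: (@leq_trans (#|pred1 q0| + (#|[pred q | (q != q0) && f q (x, a)]| +
    #|[pred q | (q != q0) && f q (x, b)]|))%N).
  rewrite !card_sum -!big_split /=; apply: leq_sum => q _.
  have [->|qq0] := eqVneq q q0; first by case: good_corner.
  case gq: (good_corner (f q) x) => //=; move/asboolP: gq.
  case=> c [d [cd fc fd lcd]]; have b01 (u v : bool) : u || v -> (0 < u + v)%N by case: u; case: v.
  apply: b01.
  apply/negPn/negP; rewrite negb_or => /andP[fqa fqb]; apply: no_tricovered.
  have neq y y' : f q (x, y) -> ~~ f q (x, y') -> y' != y.
    by move=> fy; apply: contraNneq => ->.
  apply: (@matching_tricovered x [:: (a, b); (c, d)]); rewrite ?d5 //.
    move=> p; rewrite !inE => /orP[] /eqP -> /=; split=> //.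
    - exact: fBB fa.
    - exact: fBB fb.
    - exact: fBB fc.
    - exact: fBB fd.
  rewrite /= !inE !negb_or ab cd (eq_sym c b).
  by rewrite (neq _ _ fc fqa) (neq _ _ fd fqa) (neq _ _ fc fqb) (neq _ _ fd fqb).
have card1f y : f q0 (x, y) -> (#|[pred q | (q != q0) && f q (x, y)]| <= 1)%N.
  move=> fy; have := cardf y; rewrite (cardD1 q0) inE fy add1n ltnS.
  by apply: leq_trans; apply: subset_leq_card; apply/fintype.subsetP => q; rewrite !inE.
by rewrite card1; exact: (leq_add (leqnn 1) (leq_add (card1f a fa) (card1f b fb))).
Qed.

End Discharging.

Section Reduction.
Variable G : sgraph.

Definition is_half_square (Y : finType) (B : G -> Y -> bool) :=
  forall x x' : G, x != x' -> (adj x x' <-> exists y : Y, B x y /\ B x' y).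

Lemma discharging (Y : finType) (B : G -> Y -> bool) :
  (0 < #|G|)%N -> is_half_square B -> map_dual B ->
  (forall y, degY B y != 1%N) ->
  (forall x x' y y', x != x' -> y != y' ->
     B x y -> B x' y -> B x y' -> B x' y' -> (4 <= degY B y)%N) ->
  tricovered_vertex G.
Proof.
move=> /card_gt0P[x0 _] hs [Q [l [r lr]]] deg1 deg4.
apply: contrapT => no_tri.
pose f q := face l r q.
have fB q : even_in B (f q) := face_even lr q.
pose w := weight B.
pose inf q y := [exists x, f q (x, y)].
have edges := euler lr x0.
set E := [pred e | _] in edges; set Y1 := [pred y | _] in edges.
set F := [pred q | _] in edges.
have Ef e : (\sum_q f q e <= 2 * E e)%N.
  case Ee: (E e); first exact: sum_face.
  rewrite big1 // => q _; apply/eqP; rewrite eqb0; apply/negP => fe.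
  by have := (fB q).1 e fe; rewrite -[B _ _]/(E e) Ee.
have EX : (\sum_x degX B x = #|E|)%N.
  rewrite card_sum -(pair_bigA _ (fun x y => nat_of_bool (B x y))) /=.
  by apply: eq_bigr => x _; rewrite /degX card_sum.
have EY : (\sum_y degY B y = #|E|)%N.
  rewrite card_sum -(pair_bigA _ (fun x y => nat_of_bool (B x y))) /=.
  rewrite exchange_big /=.
  by apply: eq_bigr => x _; rewrite /degY card_sum.
have chargeX : (24 * #|G| + 2 * \sum_x \sum_q good_corner B (f q) x <=
    6 * #|E|)%N.
  rewrite -EX !big_distrr /= mulnC -sum_nat_const -big_split /=.
  by apply: leq_sum => x _; apply: vertex_charge => //; apply: sum_face.
have chargeY : (24 * #|Y1| + 2 * \sum_y \sum_q inf q y * w y <=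
    12 * #|E|)%N.
  rewrite -EY !big_distrr /= card_sum big_distrr -big_split /=.
  apply: leq_sum => y _.
  have h : (2 * \sum_q inf q y <= 2 * degY B y)%N.
    rewrite big_distrr /=; apply: (@leq_trans (\sum_q \sum_x f q (x, y))%N).
      apply: leq_sum => q _; rewrite /inf; case: existsP => //= -[x fx].
      rewrite -card_sum.
      have /even_inP[_ _ /(_ y) fy] := fB q.
      have [x' x'x fx'] := xor_another fy fx.
      apply: (@uniq_leq_card _ (fun x => f q (x, y)) [:: x; x']).
        by rewrite /= inE eq_sym x'x.
      by rewrite /= fx fx'.
    rewrite exchange_big /= /degY card_sum big_distrr /=.
    by apply: leq_sum => x _; apply: Ef (x, y).
  rewrite -big_distrl /=; case: existsP => [[x xy]|noy] /=; last first.
    rewrite big1 // => q _; apply/eqP; rewrite eqb0; apply/existsP => -[x fx].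
    by apply: noy; exists x; apply: (fB q).1 fx.
  rewrite /w /weight; case: (degY_cases deg1 xy) => d; rewrite ?d /=; try lia.
  by do ![case: ifP => /eqP _]; lia.
have chargeF : (24 * #|F| <= 3 * \sum_q \sum_e f q e +
    2 * \sum_q \sum_y inf q y * w y +
    2 * \sum_q \sum_x good_corner B (f q) x)%N.
  rewrite !big_distrr /= card_sum big_distrr -!big_split /=.
  apply: leq_sum => q _; case: existsP => //= -[e fe].
  have := face_charge hs deg1 deg4 (fB q) fe; rewrite !card_sum muln1.
  rewrite [X in (2 * X)%N]big_mkcond /=.
  move=> /leq_trans; apply; rewrite leq_add2r leq_add2l leq_mul2l /=.
  by apply: leq_sum => y _; rewrite /inf; case: ifP; rewrite ?mul1n.
have : (\sum_q \sum_e f q e <= 2 * #|E|)%N.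
  rewrite exchange_big /= card_sum big_distrr /=.
  by apply: leq_sum => e _; apply: Ef.
move: chargeX chargeY chargeF edges.
rewrite [X in (_ + 2 * X <= 6 * _)%N]exchange_big.
rewrite [X in (_ + 2 * X <= 12 * _)%N]exchange_big /=.
lia.
Qed.

Lemma map_graph_tricovered (Y : finType) (B : G -> Y -> bool) :
  (0 < #|G|)%N -> is_half_square B -> map_dual B -> tricovered_vertex G.
Proof.
move=> G0; pose size (Y : finType) B := (\sum_y (@degY G Y B y) ^ 2)%N.
have [m] := ubnP (size Y B); elim: m => // m IHm in Y B * => Bm hs dB.
have delete y : (0 < degY B y)%N ->
    (forall x x', x != x' -> B x y -> B x' y ->
       exists2 y', y' != y & B x y' && B x' y') -> tricovered_vertex G.
  move=> dy redundant; pose B' x u := B x u && (u != y).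
  apply: (IHm Y B'); last by apply: map_dual_sub dB => x u /andP[].
    rewrite -ltnS; apply: leq_trans Bm; rewrite ltnS /size.
    rewrite (bigD1 y) //= [X in (_ < X)%N](bigD1 y) //=.
    have -> : degY B' y = 0.
      by apply: eq_card0 => x; rewrite !inE /B' eqxx andbF.
    rewrite exp0n // add0n -[X in (X < _)%N]add0n -addSn leq_add //.
      by rewrite expn_gt0 dy.
    apply: leq_sum => u uy; rewrite leq_sqr; apply: subset_leq_card.
    by apply/fintype.subsetP => x; rewrite !inE => /andP[].
  move=> x x' xx'; rewrite (hs x x' xx'); split=> [[u [xu x'u]]|].
    have [uy|uy] := eqVneq u y.
      rewrite uy in xu x'u; have [y' y'y /andP[xy' x'y']] := redundant x x' xx' xu x'u.
      by exists y'; rewrite /B' xy' x'y' y'y.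
    by exists u; rewrite /B' xu x'u uy.
  by case=> u [/andP[xu _] /andP[x'u _]]; exists u.
have [[y /eqP d1]|deg1] := pselect (exists y, degY B y == 1%N).
  apply: (delete y); rewrite ?d1 // => x x' xx' xy x'y.
  have : (2 <= degY B y)%N.
    apply: (@uniq_leq_card _ _ [:: x; x']); first by rewrite /= inE xx'.
    by rewrite /= xy x'y.
  by rewrite d1.
have {}deg1 y : degY B y != 1%N by apply/negP => d1; apply: deg1; exists y.
apply: contrapT => no_tri.
apply: (no_tri); apply: (discharging G0 hs dB) => // x x' y y' xx' yy' xy x'y xy' x'y'.
case: (degY_cases deg1 xy) => // dy; case: (no_tri).
  apply: (delete y) => [|v v' vv' vy v'y]; first by rewrite dy.
  exists y'; first by rewrite eq_sym.
  have := degY2 dy xx' xy x'y.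
  move=> h; case/orP: (h _ vy) => /eqP->; case/orP: (h _ v'y) => /eqP->;
    by rewrite ?xy' ?x'y'.
have [w wy] : exists w, [&& w != x, w != x' & B w y].
  apply/existsP; apply: contraT => /existsPn now.
  have : (degY B y <= 2)%N.
    apply: leq_trans (card_size [:: x; x']); apply: subset_leq_card.
    apply/fintype.subsetP => v; rewrite !inE => vy; have := now v.
    by rewrite vy andbT -negb_or negbK.
  by rewrite dy.
case/and3P: wy => wx wx' wy.
have By v : B v y = [|| v == x, v == x' | v == w].
  apply/idP/idP => [vy|/or3P[] /eqP-> //]; apply: contraT.
  rewrite !negb_or => /and3P[vx vx' vw].
  have : (4 <= degY B y)%N.
    apply: (@uniq_leq_card _ _ [:: v; w; x; x']).
      by rewrite /= !inE !negb_or vx vx' vw wx wx' xx'.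
    by rewrite /= vy wy xy x'y.
  by rewrite dy.
have xw : x != w by rewrite eq_sym.
have x'w : x' != w by rewrite eq_sym.
apply: (IHm (option Y) (split_rel B y x x' w)); last exact: map_dual_split.
  rewrite -ltnS; apply: leq_trans Bm; rewrite ltnS /size.
  rewrite (bigD1 None) //= (reindex_omap Some id) /=; last by case.
  rewrite (bigD1 y) //= [X in (_ < X)%N](bigD1 y) //= dy addnA.
  have two a b : (#|[pred v : G | (v == a) || (v == b)]| <= 2)%N.
    apply: leq_trans (card_size [:: a; b]); apply: subset_leq_card.
    by apply/fintype.subsetP => v; rewrite !inE.
  have d1 : (degY (split_rel B y x x' w) None <= 2)%N by apply: two.
  have d2 : (degY (split_rel B y x x' w) (Some y) <= 2)%N.
    by rewrite /degY /= eqxx; apply: two.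
  rewrite -addSn; apply: leq_add.
    by move: (degY _ None) (degY _ (Some y)) d1 d2 => [|[|[|?]]] [|[|[|?]]].
  apply: eq_leq; apply: eq_big => u; first by rewrite eqxx.
  by rewrite /degY /= => /andP[_ /negPf->].
move=> v v' vv'; rewrite (hs v v' vv'); split=> -[].
- move=> u [vu v'u]; have [uy|uy] := eqVneq u y; last first.
    by exists (Some u); rewrite /= (negPf uy).
  move: vu v'u; rewrite uy !By.
  have y'y : (y' == y) = false by rewrite eq_sym; apply/negbTE.
  move=> h h'; case/or3P: h h' vv' => /eqP->; case/or3P => /eqP-> //; rewrite ?eqxx // => _.
  + by exists (Some y'); rewrite /= y'y.
  + by exists (Some y); rewrite /= !eqxx orbT.
  + by exists (Some y'); rewrite /= y'y.
  + by exists None; rewrite /= !eqxx orbT.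
  + by exists (Some y); rewrite /= !eqxx orbT.
  + by exists None; rewrite /= !eqxx orbT.
- case=> [u|] /=; last first.
    by case=> h h'; exists y; rewrite !By h h' !orbT.
  case: eqP => [_ [h h']|_ [vu v'u]]; last by exists u.
  by exists y; rewrite !By; case/orP: h => ->; case/orP: h' => ->; rewrite ?orbT.
Qed.

End Reduction.

(** * Planar drawings *)

Import Order.TTheory GRing.Theory Num.Theory.
Import numFieldNormedType.Exports.

Section Compactness.
Local Open Scope ring_scope.
Local Open Scope classical_set_scope.
Variable R : realType.

Lemma compact_separated (V : normedModType R) (K L : set V) :
  compact K -> compact L -> (forall a, K a -> L a -> False) ->
  exists2 e : R, 0 < e & forall a b, K a -> L b -> e <= `|a - b|.
Proof.
move=> cK cL KL; pose f (ab : V * V) := `|ab.1 - ab.2|.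
have cf : continuous f.
  move=> ab; apply: cvg_norm; apply: cvgB; [exact: cvg_fst | exact: cvg_snd].
have cfKL : closed (f @` (K `*` L)).
  apply: compact_closed; first exact: norm_hausdorff.
  apply: continuous_compact; last exact: compact_setX.
  exact: continuous_subspaceT.
have /open_nbhs_nbhs : open_nbhs (0 : R) (~` (f @` (K `*` L))).
  split; first exact: closed_openC.
  move=> [[a b] [/= Ka Lb]] /normr0_eq0/subr0_eq ab.
  by move: ab => /= ab; apply: (KL a) => //; rewrite ab.
move/nbhs_ballP => [e /= e0 eKL]; exists e => // a b Ka Lb.
rewrite leNgt; apply/negP => ab.
apply: (eKL `|a - b|); last by exists (a, b).
by rewrite /ball /= sub0r normrN normr_id.
Qed.

Lemma finite_small (I : finType) (P : I -> R -> Prop) :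
  (forall i e e', 0 < e' -> e' <= e -> P i e -> P i e') ->
  (forall i, exists2 e, 0 < e & P i e) ->
  exists2 e, 0 < e & forall i, P i e.
Proof.
move=> mono /(_ _)/cid2-/all_sig2[e e0 eP].
exists (\big[Num.min/1]_i e i).
  by apply: lt_bigmin => // i _.
move=> i; apply: mono (eP i); last exact: bigmin_le_cond.
by apply: lt_bigmin => // j _.
Qed.

Lemma unit_interval_ind (P : R -> Prop) :
  (forall t, 0 <= t <= 1 -> exists2 e, 0 < e &
     forall s, 0 <= s <= 1 -> `|s - t| < e -> P s <-> P t) ->
  P 0 -> P 1.
Proof.
move=> loc P0; pose A : set R := [set s | 0 <= s <= 1 /\ P s].
have A0 : A 0 by split=> //; rewrite lexx ler01.
have supA : has_sup A.
  by split; [exists 0 | exists 1 => s [/andP[]]].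
pose t := sup A.
have t01 : 0 <= t <= 1.
  rewrite (ub_le_sup supA.2 A0) /=; apply: ge_sup; first by exists 0.
  by move=> s [/andP[]].
have [e e0 et] := loc t t01.
have Pt : P t.
  have [s As ts] := sup_adherent e0 supA.
  have st : s <= t by apply: ub_le_sup => //; exact: supA.2.
  case: As => s01 Ps; apply/(et s s01) => //.
  by rewrite ler0_norm ?subr_le0 // opprB ltrBlDl -ltrBlDr.
have [t1|t1] := leP 1 t.
  by have -> : 1 = t by apply/eqP; rewrite eq_le t1 (andP t01).2.
pose s := Num.min 1 (t + e / 2).
have st : t < s by rewrite lt_min t1 ltrDl divr_gt0.
have s01 : 0 <= s <= 1.
  by rewrite ge_min lexx /= andbT; apply: le_trans (ltW st); case/andP: t01.
suff : s <= t by rewrite leNgt st.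
apply: ub_le_sup; first exact: supA.2.
split=> //; apply/(et s s01) => //.
rewrite gtr0_norm ?subr_gt0 // ltrBlDl.
by rewrite gt_min ltrD2l ltr_pdivrMr // ltr_pMr // ltr1n orbT.
Qed.

Lemma within_continuous_dist (V : normedModType R) (g : R -> V) t (d : R) :
  {within `[0, 1], continuous g} -> 0 <= t <= 1 -> 0 < d ->
  exists2 e, 0 < e & forall s, 0 <= s <= 1 -> `|s - t| < e -> `|g s - g t| < d.
Proof.
move=> /subspace_continuousP cg t01 d0.
have /cg /cvgrPdist_lt/(_ d d0) : `[0, 1] t by rewrite /= in_itv.
rewrite near_withinE => /nbhs_ballP[e /= e0 eg]; exists e => // s s01 st.
rewrite distrC; apply: eg; last by rewrite /= in_itv.
by rewrite /ball /= distrC.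
Qed.

End Compactness.

Section TorusMinor.
Variables (X Y : finType) (B : X -> Y -> bool) (n : nat).
Let P : finType := ('I_n.+1 * 'I_n.+1)%type.
Variables (beta : P -> option (X + Y)) (base : X + Y -> P).

Definition torus_adj : rel P := fun p q =>
  [exists e, (torus_src e == p) && (torus_tgt e == q) ||
             (torus_src e == q) && (torus_tgt e == p)].

Lemma torus_adj_sym : symmetric torus_adj.
Proof. by move=> p q; apply: eq_existsb => e; rewrite orbC. Qed.

Lemma inner_adj_torus p q : torus_adj p q -> beta p != None ->
  beta p = beta q -> inner_adj (@torus_src n) (@torus_tgt n) beta p q.
Proof.
case/existsP=> e he p0 pq; apply/existsP; exists e; rewrite he andbT.
rewrite /inner_edge; case/orP: he => /andP[/eqP-> /eqP->].
  by rewrite p0 pq eqxx.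
by rewrite -pq p0 eqxx.
Qed.

Hypothesis base_conn : forall p u, beta p = Some u ->
  connect (inner_adj (@torus_src n) (@torus_tgt n) beta) p (base u).
Hypothesis no_wrap : forall p, beta p != None ->
  (p.1 != ord_max) && (p.2 != ord_max).
Hypothesis edges : forall x y, B x y -> exists p q,
  [/\ beta p = Some (inl x), beta q = Some (inr y) & torus_adj p q].

Lemma torus_minor : map_dual B.
Proof.
pose s : X * Y -> X + Y := fun e => inl e.1.
pose t : X * Y -> X + Y := fun e => inr e.2.
pose good (xy : X * Y) (e : bool * P) := B xy.1 xy.2 ->
  (beta (torus_src e) = Some (s xy) /\ beta (torus_tgt e) = Some (t xy)) \/
  (beta (torus_src e) = Some (t xy) /\ beta (torus_tgt e) = Some (s xy)).
have /choice[eps epsP] e' : exists e, good e' e.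
  case: e' => x y; case xy: (B x y); last first.
    by exists (true, (ord0, ord0)); rewrite /good /= xy.
  have [p [q [px qy /existsP[e he]]]] := edges xy.
  exists e => _; case/orP: he => /andP[/eqP-> /eqP->]; rewrite px qy; by auto.
pose BB (e : X * Y) := B e.1 e.2.
have eps_inj : {in BB &, injective eps}.
  move=> [x y] [x' y'] Bxy Bxy' eE.
  have := epsP _ Bxy'; rewrite -eE.
  by case: (epsP _ Bxy) => -[-> ->]; rewrite /s /t /= => -[] [] // [->] [->].
have no_loop e : s e != t e by [].
apply: (dual_minor (Q := P)
  (Z := fun z => forall p, boundary (@torus_src n) (@torus_tgt n) z p = false)
  (D := fun e => ~~ (inner_edge (@torus_src n) (@torus_tgt n) beta e ||
                     [exists e', BB e' && (eps e' == e)]))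
  (iota := fun e' => if BB e' then Some (eps e') else None)).
- exact: torus_coboundary_cycle.
- move=> z zc zD; apply: torus_cycle_coboundary zc _ => b i j ij.
  apply: zD; rewrite negb_or.
  have bN : beta (i, j) = None.
    apply/eqP; apply: contraTT ij => /no_wrap /=.
    by rewrite -negb_or.
  rewrite /inner_edge /= bN /=; apply/existsPn => e'.
  apply/negP => /andP[Be' /eqP eE].
  by case: (epsP _ Be') => -[]; rewrite eE /= bN.
- exact: (minor_cycle base_conn eps_inj epsP no_loop).
Qed.

End TorusMinor.

Lemma connect_restrict (T : finType) (e e' : rel T) a b :
  (forall u v, connect e a u -> e u v -> e' u v) ->
  connect e a b -> connect e' a b.
Proof.
move=> ee' /connectP[c ec ->] {b}.
elim: c a ee' ec => [|u c IHc] a ee' /=; first by rewrite connect0.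
case/andP=> au uc; apply: (@connect_trans _ _ u); first exact/connect1/ee'.
apply: IHc uc => v w uv; apply: ee'.
by apply: connect_trans uv; apply: connect1.
Qed.

Lemma connect_convex (n : nat) (T : finType) (e : rel T) (f : 'I_n.+1 -> T)
    (I : pred 'I_n.+1) :
  symmetric e ->
  (forall i j k : 'I_n.+1, (i <= j <= k)%N -> I i -> I k -> I j) ->
  (forall i, i != ord_max -> I i -> I (ordS i) -> e (f i) (f (ordS i))) ->
  forall i j, I i -> I j -> connect e (f i) (f j).
Proof.
move=> e_sym Iconv step.
have up (i j : 'I_n.+1) : (i <= j)%N -> I i -> I j -> connect e (f i) (f j).
  move=> ij; have [m] := ubnP (j - i); elim: m => // m IHm in i ij *.
  move=> jim Ii Ij; have [->|neij] := eqVneq i j; first exact: connect0.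
  have ltij : (i < j)%N by rewrite ltn_neqAle ij andbT.
  have iN : i != ord_max.
    by apply: contraTneq ltij => ->; rewrite -leqNgt -ltnS.
  have iS := ordS_val iN.
  have IS : I (ordS i) by apply: (Iconv i _ j); rewrite // iS ltij leqnSn.
  apply: (@connect_trans _ _ (f (ordS i))); first exact/connect1/step.
  by apply: IHm; rewrite ?iS //; lia.
move=> i j Ii Ij; have [ij|/ltnW ji] := leqP i j; first exact: up.
by rewrite (sym_connect_sym e_sym); apply: up.
Qed.

Section LatticeModel.
Local Open Scope classical_set_scope.
Local Open Scope ring_scope.
Variables (R : realType) (X Y : finType) (B : X -> Y -> bool).
Variables (px : X -> R * R) (py : Y -> R * R) (g : X -> Y -> R -> R * R).
Variables (r delta M : R) (n : nat).
Hypotheses (delta0 : 0 < delta) (delta_r : 2 * delta <= r).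
Hypothesis n_large : 2 * M + 2 * r < delta * n%:R.
Hypothesis g_cont : forall x y, B x y ->
  {within `[0, 1], continuous (g x y)}.
Hypothesis g0 : forall x y, B x y -> g x y 0 = px x.
Hypothesis g1 : forall x y, B x y -> g x y 1 = py y.
Hypothesis gM : forall x y s, B x y -> 0 <= s <= 1 -> `|g x y s| <= M.
Hypothesis pyM : forall y, `|py y| <= M.
Hypothesis sepY : forall y y', y != y' -> 4 * r < `|py y - py y'|.
Hypothesis sep_end : forall x y, B x y -> 4 * r < `|px x - py y|.
Hypothesis sep_arcY : forall x y y' s, B x y -> y' != y -> 0 <= s <= 1 ->
  4 * r < `|g x y s - py y'|.
Hypothesis sep_arcs : forall x y x' y' s s', B x y -> B x' y' -> x != x' ->
  0 <= s <= 1 -> 0 <= s' <= 1 ->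
  r <= `|g x y s - py y| -> r <= `|g x' y' s' - py y'| ->
  4 * delta < `|g x y s - g x' y' s'|.

Let P : finType := ('I_n.+1 * 'I_n.+1)%type.

Definition grid_index (t : R) : nat := Num.truncn ((t + M) / delta).
Definition cell (a : R * R) : P := (inord (grid_index a.1), inord (grid_index a.2)).
Definition grid_point (u : P) : R * R :=
  (delta * u.1%:R - M, delta * u.2%:R - M).

Lemma pair_norm_le (a : R * R) (e : R) :
  (`|a| <= e) = (`|a.1| <= e) && (`|a.2| <= e).
Proof. by rewrite prod_normE ge_max. Qed.

Lemma pair_norm_lt (a : R * R) (e : R) :
  (`|a| < e) = (`|a.1| < e) && (`|a.2| < e).
Proof. by rewrite prod_normE gt_max. Qed.

Lemma grid_index_itv t : `|t| <= M ->
  delta * (grid_index t)%:R <= t + M < delta * (grid_index t).+1%:R.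
Proof.
rewrite ler_norml => /andP[tM _].
have : 0 <= (t + M) / delta by rewrite divr_ge0 ?(ltW delta0) //; lra.
move/truncn_itv; rewrite -/(grid_index t) => /andP[h1 h2].
by rewrite mulrC -ler_pdivlMr // h1 mulrC -ltr_pdivrMr.
Qed.

Lemma r_gt0 : 0 < r. Proof. by move: delta0 delta_r; lra. Qed.

Lemma grid_index_lt t : `|t| <= M -> (grid_index t < n)%N.
Proof.
move=> tM; have /andP[h _] := grid_index_itv tM.
move: tM; rewrite ler_norml => /andP[_ tM].
rewrite -(ltr_nat R) -(ltr_pM2l delta0); apply: le_lt_trans h _.
by apply: le_lt_trans n_large; have := r_gt0; lra.
Qed.

Lemma grid_index_close t t' : `|t| <= M -> `|t'| <= M -> `|t - t'| < delta ->
  (grid_index t' <= (grid_index t).+1)%N.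
Proof.
move=> /grid_index_itv/andP[_ h] /grid_index_itv/andP[h' _]; rewrite ltr_norml.
move=> /andP[tt' _]; rewrite -ltnS -(ltr_nat R) -(ltr_pM2l delta0).
apply: le_lt_trans h' _.
rewrite -[(grid_index t).+2]addn1 natrD mulrDr mulr1; lra.
Qed.

Lemma val_cell1 a : `|a| <= M -> (cell a).1 = grid_index a.1 :> nat.
Proof.
rewrite pair_norm_le => /andP[/grid_index_lt h _]; rewrite inordK //.
exact: ltn_trans h _.
Qed.

Lemma val_cell2 a : `|a| <= M -> (cell a).2 = grid_index a.2 :> nat.
Proof.
rewrite pair_norm_le => /andP[_ /grid_index_lt h]; rewrite inordK //.
exact: ltn_trans h _.
Qed.

Lemma grid_index_near t : `|t| <= M -> `|delta * (grid_index t)%:R - M - t| <= delta.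
Proof.
move=> /grid_index_itv/andP[h1]; rewrite -addn1 natrD mulrDr mulr1 => h2.
by rewrite ler_norml; apply/andP; split; lra.
Qed.

Lemma grid_point_cell a : `|a| <= M -> `|grid_point (cell a) - a| <= delta.
Proof.
move=> aM; rewrite pair_norm_le /grid_point val_cell1 // val_cell2 //=.
by move: aM; rewrite pair_norm_le => /andP[h1 h2]; rewrite !grid_index_near.
Qed.

Lemma near_not_max (i : nat) (t' : R) : `|t'| <= M ->
  `|delta * i%:R - M - t'| <= 2 * r -> (i != n)%N.
Proof.
rewrite !ler_norml => /andP[_ t'M] /andP[_ h].
apply/eqP => iE; move: n_large; rewrite -iE; lra.
Qed.

Lemma torus_adj_fst (i i' j : 'I_n.+1) : i' = i.+1 :> nat ->
  torus_adj ((i, j) : P) (i', j).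
Proof.
move=> h; apply/existsP; exists (true, (i, j)).
rewrite /torus_src /torus_tgt /= eqxx /=; apply/orP; left.
rewrite xpair_eqE eqxx andbT; apply/eqP/ord_inj.
by rewrite ordS_val //; apply/eqP => /(congr1 val) /= E; have := ltn_ord i'; lia.
Qed.

Lemma torus_adj_snd (i j j' : 'I_n.+1) : j' = j.+1 :> nat ->
  torus_adj ((i, j) : P) (i, j').
Proof.
move=> h; apply/existsP; exists (false, (i, j)).
rewrite /torus_src /torus_tgt /= eqxx /=; apply/orP; left.
rewrite xpair_eqE eqxx /=; apply/eqP/ord_inj.
by rewrite ordS_val //; apply/eqP => /(congr1 val) /= E; have := ltn_ord j'; lia.
Qed.

Lemma torus_step_fst (i i' j : 'I_n.+1) : (i <= i'.+1)%N -> (i' <= i.+1)%N ->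
  ((i, j) : P) = (i', j) \/ torus_adj ((i, j) : P) (i', j).
Proof.
move=> h h'; have [e|[e|e]] : i = i' :> nat \/ i' = i.+1 :> nat \/
  i = i'.+1 :> nat by lia.
- by left; rewrite (ord_inj e).
- by right; apply: torus_adj_fst.
- by right; rewrite torus_adj_sym; apply: torus_adj_fst.
Qed.

Lemma torus_step_snd (i j j' : 'I_n.+1) : (j <= j'.+1)%N -> (j' <= j.+1)%N ->
  ((i, j) : P) = (i, j') \/ torus_adj ((i, j) : P) (i, j').
Proof.
move=> h h'; have [e|[e|e]] : j = j' :> nat \/ j' = j.+1 :> nat \/
  j = j'.+1 :> nat by lia.
- by left; rewrite (ord_inj e).
- by right; apply: torus_adj_snd.
- by right; rewrite torus_adj_sym; apply: torus_adj_snd.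
Qed.

(* Vertices of [Y] become square blocks of grid points; a vertex [x] becomes the
   component, near [px x], of the grid points that are close to the arcs leaving
   [px x] and outside all blocks. *)
Definition block y (u : P) := `|grid_point u - py y| <= 2 * r.

Definition sleeve x (u : P) := [forall y, ~~ block y u] && `[< exists y s,
  [/\ B x y, 0 <= s <= 1 & `|grid_point u - g x y s| <= 2 * delta] >].

Definition sleeve_adj x : rel P :=
  [rel u v | [&& sleeve x u, sleeve x v & torus_adj u v]].

Definition branch x (u : P) :=
  sleeve x u && connect (sleeve_adj x) (cell (px x)) u.

Definition beta (u : P) : option (X + Y) :=
  if [pick y | block y u] is Some y then Some (inr y) else
  if [pick x | branch x u] is Some x then Some (inl x) else None.

Definition base (v : X + Y) : P :=
  match v with inl x => cell (px x) | inr y => cell (py y) end.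

Lemma dist_triangle (a b c : R * R) : `|b - c| <= `|a - b| + `|a - c|.
Proof. by rewrite -(distrC b a) ler_distD. Qed.

Lemma block_uniq y y' u : block y u -> block y' u -> y = y'.
Proof.
move=> h h'; apply/eqP; apply: contraT => /sepY.
have := dist_triangle (grid_point u) (py y) (py y'); rewrite /block in h h'; lra.
Qed.

Lemma sleeve_uniq x x' u : sleeve x u -> sleeve x' u -> x = x'.
Proof.
move=> /andP[/forallP nb /asboolP[y [s [xy s01 us]]]].
move=> /andP[_ /asboolP[y' [s' [x'y' s'01 us']]]].
apply/eqP; apply: contraT => xx'.
have far z a : `|grid_point u - a| <= 2 * delta -> r <= `|a - py z|.
  move=> ua; have := nb z; rewrite /block -ltNge => h.
  have := ler_distD a (grid_point u) (py z); have := delta_r; lra.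
have := sep_arcs xy x'y' xx' s01 s'01 (far _ _ us) (far _ _ us').
by have := dist_triangle (grid_point u) (g x y s) (g x' y' s'); lra.
Qed.

Lemma betaY y u : block y u -> beta u = Some (inr y).
Proof.
rewrite /beta => yu; case: pickP => [y' y'u|/(_ y)]; last by rewrite yu.
by rewrite (block_uniq y'u yu).
Qed.

Lemma betaX x u : branch x u -> beta u = Some (inl x).
Proof.
rewrite /beta => xu; have /andP[/andP[/forallP nb _] _] := xu.
case: pickP => [y yu|_]; first by have := nb y; rewrite yu.
case: pickP => [x' x'u|/(_ x)]; last by rewrite xu.
by case/andP: xu x'u => xu _ /andP[x'u _]; rewrite (sleeve_uniq x'u xu).
Qed.

Lemma beta_inv u v : beta u = Some v ->
  match v with inl x => branch x u | inr y => block y u end.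
Proof.
rewrite /beta; case: pickP => [y yu [<-] //|_].
by case: pickP => [x xu [<-] //|].
Qed.

Lemma no_wrap u : beta u != None -> (u.1 != ord_max) && (u.2 != ord_max).
Proof.
case E: (beta u) => [v|] // _.
have [a aM ua] : exists2 a, `|a| <= M & `|grid_point u - a| <= 2 * r.
  have := beta_inv E; case: v {E} => [x|y] h; last by exists (py y).
  case/andP: h => /andP[_ /asboolP[y [s [xy s01 us]]]] _.
  exists (g x y s); first exact: gM.
  by have := delta_r; have := r_gt0; lra.
move: aM ua; rewrite !pair_norm_le => /andP[aM1 aM2] /andP[ua1 ua2].
have neq (i : 'I_n.+1) : (i != n :> nat)%N -> i != ord_max.
  by apply: contra => /eqP->.
by apply/andP; split; apply: neq; [exact: near_not_max aM1 ua1 | exact: near_not_max aM2 ua2].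
Qed.

Let inner := inner_adj (@torus_src n) (@torus_tgt n) beta.

Lemma inner_sym : symmetric inner.
Proof.
by move=> p q; apply: eq_existsb => e; rewrite [in RHS]orbC.
Qed.

Lemma block_conn y u : block y u -> connect inner u (cell (py y)).
Proof.
have cy : block y (cell (py y)).
  rewrite /block; have := grid_point_cell (pyM y); have := delta_r; have := r_gt0.
  by move: delta0; lra.
have step p q : block y p -> block y q -> torus_adj p q -> inner p q.
  by move=> /betaY hp /betaY hq pq; apply: inner_adj_torus; rewrite ?hp ?hq.
have conv (c : R) (i j k : 'I_n.+1) : (i <= j <= k)%N ->
    `|delta * i%:R - M - c| <= 2 * r -> `|delta * k%:R - M - c| <= 2 * r ->
    `|delta * j%:R - M - c| <= 2 * r.
  move=> /andP[ij jk].
  have {}ij : delta * i%:R <= delta * j%:R by rewrite ler_pM2l // ler_nat.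
  have {}jk : delta * j%:R <= delta * k%:R by rewrite ler_pM2l // ler_nat.
  rewrite !ler_norml => /andP[h1 h2] /andP[h3 h4].
  by apply/andP; split; lra.
case: u => i j u.
move: cy (u); rewrite {1 2}/block !pair_norm_le /= => /andP[c1 c2] /andP[u1 u2].
apply: (@connect_trans _ _ ((cell (py y)).1, j)).
  apply: (connect_convex (f := fun i => (i, j))
    (I := fun i : 'I_n.+1 => `|delta * i%:R - M - (py y).1| <= 2 * r)) => //.
  - exact: inner_sym.
  - exact: conv.
  move=> k kN h1 h2; apply: step; rewrite ?/block ?pair_norm_le /= ?h1 ?h2 //.
  by apply: torus_adj_fst; rewrite ordS_val.
rewrite [X in connect _ _ X]surjective_pairing.
apply: (connect_convex (f := fun j => ((cell (py y)).1, j))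
  (I := fun j : 'I_n.+1 => `|delta * j%:R - M - (py y).2| <= 2 * r)) => //.
- exact: inner_sym.
- exact: conv.
move=> k kN h1 h2; apply: step; rewrite ?/block ?pair_norm_le /= ?h1 ?h2 ?c1 //.
by apply: torus_adj_snd; rewrite ordS_val.
Qed.

Lemma branch_conn x u : branch x u -> connect inner u (cell (px x)).
Proof.
case/andP=> _ xu; rewrite (sym_connect_sym inner_sym).
apply: connect_restrict xu => v w cv /= /and3P[vx wx vw].
have cw : connect (sleeve_adj x) (cell (px x)) w.
  by apply: (connect_trans cv); apply: connect1; apply/and3P.
have hv : beta v = Some (inl x) by apply: betaX; rewrite /branch vx cv.
have hw : beta w = Some (inl x) by apply: betaX; rewrite /branch wx cw.
by apply: inner_adj_torus; rewrite ?hv ?hw.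
Qed.

Section Arc.
Variables (x : X) (y : Y).
Hypothesis xy : B x y.
Hypothesis no_edge : forall u v, branch x u -> block y v -> ~~ torus_adj u v.

Lemma branch_step u v s : branch x u -> u = v \/ torus_adj u v ->
  0 <= s <= 1 -> `|grid_point v - g x y s| <= 2 * delta -> branch x v.
Proof.
move=> xu [<-//|uv] s01 vs.
have xv : sleeve x v.
  apply/andP; split; last by apply/asboolP; exists y, s.
  apply/forallP => y'; apply/negP => vy'.
  have [y'y|y'y] := eqVneq y' y.
    by have := no_edge xu; rewrite -y'y => /(_ _ vy'); rewrite uv.
  have := sep_arcY xy y'y s01; have := dist_triangle (grid_point v) (g x y s) (py y').
  by move: delta_r r_gt0; rewrite /block in vy'; lra.
case/andP: xu => xu cu; rewrite /branch xv /=; apply: (connect_trans cu).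
by apply: connect1; apply/and3P.
Qed.

Lemma branch_close s t : 0 <= s <= 1 -> 0 <= t <= 1 ->
  `|g x y s - g x y t| < delta ->
  branch x (cell (g x y s)) -> branch x (cell (g x y t)).
Proof.
move=> s01 t01 st cs.
have sM := gM xy s01; have tM := gM xy t01.
have ts : `|g x y t - g x y s| < delta by rewrite distrC.
pose c := ((cell (g x y t)).1, (cell (g x y s)).2) : P.
move: (sM) (tM) st ts; rewrite !pair_norm_le !pair_norm_lt.
move=> /andP[sM1 sM2] /andP[tM1 tM2] /andP[st1 st2] /andP[ts1 ts2].
have cc : branch x c.
  apply: (branch_step cs _ s01).
    rewrite [cell (g x y s)]surjective_pairing.
    by apply: torus_step_fst; rewrite !val_cell1 //; apply: grid_index_close.
  rewrite pair_norm_le /= val_cell1 // val_cell2 //.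
  have := grid_index_near tM1; have := grid_index_near sM2; move: ts1 delta0.
  rewrite !ler_norml !ltr_norml => /andP[h1 h2] h /andP[h3 h4] /andP[h5 h6].
  by apply/andP; split; apply/andP; split; lra.
apply: (branch_step cc _ t01).
  rewrite [cell (g x y t)]surjective_pairing.
  by apply: torus_step_snd; rewrite !val_cell2 //; apply: grid_index_close.
by apply: le_trans (grid_point_cell tM) _; move: delta0; lra.
Qed.

(* Otherwise the branch of [x] could be followed along the whole arc up to the
   block of [y], which it avoids. *)
Lemma branch_reaches_block : False.
Proof.
have I0 : 0 <= (0 : R) <= 1 by rewrite lexx ler01.
have I1 : 0 <= (1 : R) <= 1 by rewrite lexx ler01.
have : branch x (cell (g x y 1)).
  apply: (unit_interval_ind (P := fun s => branch x (cell (g x y s)))).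
    move=> t t01; have [e e0 eg] := within_continuous_dist (g_cont xy) t01 delta0.
    exists e => // s s01 st; have h := eg s s01 st.
    by split; apply: branch_close => //; rewrite distrC.
  rewrite g0 // /branch connect0 andbT.
  have pM : `|px x| <= M by rewrite -(g0 xy) gM.
  have near := grid_point_cell pM.
  apply/andP; split; last first.
    apply/asboolP; exists y, 0; split=> //; rewrite g0 //.
    by move: delta0; lra.
  apply/forallP => y'; apply/negP => h.
  have far : 4 * r < `|px x - py y'|.
    have [->|y'y] := eqVneq y' y; first exact: sep_end.
    by rewrite -(g0 xy); apply: sep_arcY.
  have := dist_triangle (grid_point (cell (px x))) (px x) (py y').
  by move: delta_r r_gt0 delta0; rewrite /block in h; lra.
case/andP => /andP[/forallP/(_ y)/negP + _] _; apply.
rewrite g1 // /block; have := grid_point_cell (pyM y).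
by move: delta_r r_gt0 delta0; lra.
Qed.

End Arc.

Lemma lattice_model : map_dual B.
Proof.
apply: (@torus_minor X Y B n beta base).
- move=> u [x|y] /beta_inv; [exact: branch_conn | exact: block_conn].
- exact: no_wrap.
- move=> x y xy; apply: contrapT => no_edge; apply: (branch_reaches_block xy).
  move=> u v xu yv; apply/negP => uv; apply: no_edge; exists u, v.
  by split=> //; [exact: betaX | exact: betaY].
Qed.

End LatticeModel.

Section Planar.
Local Open Scope classical_set_scope.
Local Open Scope ring_scope.
Variable R : realType.

Lemma arc_compact (g : R -> R * R) :
  {within `[0, 1], continuous g} -> compact (g @` `[0, 1]).
Proof. by move=> cg; apply: continuous_compact => //; apply: segment_compact. Qed.

Lemma planar_map_dual (X Y : finType) (B : X -> Y -> bool) :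
  planar R (bipartite_graph B) -> map_dual B.
Proof.
case=> [p [arc [p_inj arcs _ arc_vertex arc_arc]]].
pose px x := p (inl x); pose py y := p (inr y).
have /choice[g gP] (xy : X * Y) : exists g : R -> R * R, B xy.1 xy.2 ->
    [/\ {within `[0, 1], continuous g}, set_inj `[0, 1] g,
        g 0 = px xy.1, g 1 = py xy.2 &
        g @` `[0, 1] = arc (inl xy.1) (inr xy.2)].
  case Bxy: (B xy.1 xy.2); last by exists (fun=> 0).
  by have [g gP] := arcs (inl xy.1) (inr xy.2) Bxy; exists g.
pose K (e : X * Y) := g e @` `[0, 1].
have Kc e : B e.1 e.2 -> compact (K e).
  by move=> /gP[cg _ _ _ _]; apply: arc_compact.
have in_arc e s : B e.1 e.2 -> 0 <= s <= 1 -> arc (inl e.1) (inr e.2) (g e s).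
  by move=> /gP[_ _ _ _ <-] s01; exists s => //; rewrite /= in_itv.
have arc_end e s u : B e.1 e.2 -> 0 <= s <= 1 -> g e s = p u ->
    u = inl e.1 \/ u = inr e.2.
  move=> Be s01 gs; apply: arc_vertex => //; rewrite -gs; exact: in_arc.
have arc_meet e e' s s' : B e.1 e.2 -> B e'.1 e'.2 -> e.1 != e'.1 ->
    0 <= s <= 1 -> 0 <= s' <= 1 -> g e s = g e' s' -> g e s = py e.2.
  move=> Be Be' ee' s01 s'01 gg.
  have [w _ pw] : range p (g e s).
    apply: (arc_arc (inl e.1) (inr e.2) (inl e'.1) (inr e'.2)) => //.
    - by case=> h; rewrite h eqxx in ee'.
    - by split; [exact: in_arc | rewrite gg; exact: in_arc].
  case: (arc_end e s w) => // wE; last by rewrite -pw wE.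
  case: (arc_end e' s' w) => //; rewrite -?gg ?pw // wE => -[] // h.
  by rewrite h eqxx in ee'.
have dist_compact e a : B e.1 e.2 -> (forall s, 0 <= s <= 1 -> g e s <> a) ->
    exists2 c : R, 0 < c & forall s, 0 <= s <= 1 -> c <= `|g e s - a|.
  move=> Be nea; have [|c c0 h] := compact_separated (Kc e Be) (@compact_set1 _ a).
    by move=> b [s s01 <-]; apply: nea; rewrite /= in_itv in s01.
  by exists c => // s s01; apply: h => //; exists s; rewrite //= in_itv.
have [r1 r10 sepY] : exists2 r : R, 0 < r & forall yy' : Y * Y,
    yy'.1 != yy'.2 -> 4 * r < `|py yy'.1 - py yy'.2|.
  apply: finite_small => [i e e' e'0 e'e h /h|[y y'] /=].
    by apply: le_lt_trans; rewrite ler_pM2l.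
  have [->|yy'] := eqVneq y y'; first by exists 1.
  exists (`|py y - py y'| / 8).
    rewrite divr_gt0 // normr_gt0 subr_eq0; apply: contra yy' => /eqP.
    by move/p_inj => -[->].
  move=> _; have : 0 < `|py y - py y'|.
    rewrite normr_gt0 subr_eq0; apply: contra yy' => /eqP.
    by move/p_inj => -[->].
  lra.
have [r2 r20 sep_end] : exists2 r : R, 0 < r & forall e : X * Y,
    4 * r < `|px e.1 - py e.2|.
  apply: finite_small => [i e e' e'0 e'e h|[x y] /=].
    by apply: le_lt_trans h; rewrite ler_pM2l.
  have d0 : 0 < `|px x - py y|.
    by rewrite normr_gt0 subr_eq0; apply/eqP => /p_inj.
  by exists (`|px x - py y| / 8); lra.
have [r3 r30 sep_arcY] : exists2 r : R, 0 < r & forall ey : (X * Y) * Y,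
    B ey.1.1 ey.1.2 -> ey.2 != ey.1.2 -> forall s, 0 <= s <= 1 ->
    4 * r < `|g ey.1 s - py ey.2|.
  apply: finite_small => [i e e' e'0 e'e h Bi iy s s01|[e y] /=].
    by apply: le_lt_trans (h Bi iy s s01); rewrite ler_pM2l.
  case Be: (B e.1 e.2); last by exists 1.
  have [->|ye] := eqVneq y e.2; first by exists 1.
  have [|c c0 h] := dist_compact e (py y) Be.
    move=> s s01 /(arc_end e s _ Be s01)[] // [] yE.
    by rewrite yE eqxx in ye.
  exists (c / 8); first by rewrite divr_gt0.
  by move=> _ _ s s01; apply: lt_le_trans (h s s01); lra.
pose r := Num.min r1 (Num.min r2 r3).
have r0 : 0 < r by rewrite !lt_min r10 r20 r30.
have [rr1 rr2 rr3] : [/\ r <= r1, r <= r2 & r <= r3].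
  by rewrite /r !ge_min !lexx !orbT.
pose L e := K e `&` [set a | r <= `|a - py e.2|].
have Lc e : B e.1 e.2 -> compact (L e).
  move=> Be; apply: compact_closedI; first exact: Kc.
  have -> : [set a | r <= `|a - py e.2|] =
            (fun a => `|a - py e.2|) @^-1` [set t | r <= t] by [].
  apply: closed_comp; last exact: closed_ge.
  by move=> a _; apply: cvg_norm; apply: cvgB; [exact: cvg_id | exact: cvg_cst].
have [eta eta0 sep_arcs] : exists2 r' : R, 0 < r' & forall ee : (X * Y) * (X * Y),
    B ee.1.1 ee.1.2 -> B ee.2.1 ee.2.2 -> ee.1.1 != ee.2.1 ->
    forall s s', 0 <= s <= 1 -> 0 <= s' <= 1 ->
    r <= `|g ee.1 s - py ee.1.2| -> r <= `|g ee.2 s' - py ee.2.2| ->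
    r' <= `|g ee.1 s - g ee.2 s'|.
  apply: finite_small => [i e e' e'0 e'e h Bi iy h1 s s' s01 s'01 h2 h3|[e e'] /=].
    by apply: le_trans e'e (h Bi iy h1 s s' s01 s'01 h2 h3).
  case Be: (B e.1 e.2); last by exists 1.
  case Be': (B e'.1 e'.2); last by exists 1.
  have [_|ee'] := eqVneq e.1 e'.1; first by exists 1.
  have [|c c0 h] := compact_separated (Lc e Be) (Lc e' Be').
    move=> a [[s /= s01 <-] /= far] [[s' /= s'01 gg] _].
    rewrite !in_itv /= in s01 s'01.
    move: far; rewrite (arc_meet e e' s s') // subrr normr0.
    by rewrite leNgt r0.
  exists c => // _ _ _ s s' s01 s'01 h1 h2.
  by apply: h; split=> //; [exists s | exists s'] => //; rewrite /= in_itv.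
have [M' M'0 gM'] : exists2 c : R, 0 < c & forall e : X * Y, B e.1 e.2 ->
    forall s, 0 <= s <= 1 -> `|g e s| <= c^-1.
  apply: finite_small => [i e e' e'0 e'e h Bi s s01|e].
    by apply: le_trans (h Bi s s01) _; rewrite lef_pV2 // posrE; exact: lt_le_trans e'e.
  case Be: (B e.1 e.2); last by exists 1.
  have [m [_ mP]] := compact_bounded (Kc e Be).
  exists (`|m| + 1)^-1; first by rewrite invr_gt0 ltr_wpDl.
  move=> _ s s01; rewrite invrK; apply: mP; last by exists s; rewrite //= in_itv.
  by rewrite ltr_pwDr // ler_norm.
pose M := M'^-1 + \sum_y `|py y|.
have pyM y : `|py y| <= M.
  rewrite /M (bigD1 y) //= addrCA lerDl addr_ge0 ?invr_ge0 ?(ltW M'0) //.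
  by apply: sumr_ge0.
have gM x y s : B x y -> 0 <= s <= 1 -> `|g (x, y) s| <= M.
  move=> Bxy s01; apply: le_trans (gM' (x, y) Bxy s s01) _.
  by rewrite /M lerDl; apply: sumr_ge0.
pose delta := Num.min r eta / 8.
have delta0 : 0 < delta by rewrite divr_gt0 // lt_min r0 eta0.
have delta_r : 2 * delta <= r.
  have : Num.min r eta <= r by rewrite ge_min lexx.
  by rewrite /delta; move: r0; lra.
have delta_eta : 4 * delta < eta.
  have : Num.min r eta <= eta by rewrite ge_min lexx orbT.
  by rewrite /delta; move: eta0; lra.
pose n := Num.bound ((2 * M + 2 * r) / delta).
have n_large : 2 * M + 2 * r < delta * n%:R.
  rewrite [delta * _]mulrC -ltr_pdivrMr //; apply: archi_boundP.
  rewrite divr_ge0 ?(ltW delta0) //.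
  have M0 : 0 <= M by rewrite addr_ge0 ?invr_ge0 ?(ltW M'0) // sumr_ge0.
  by move: r0; lra.
apply: (@lattice_model R X Y B px py (fun x y => g (x, y)) r delta M n) => //.
- by move=> x y Bxy; have [] := gP (x, y) Bxy.
- by move=> x y Bxy; have [] := gP (x, y) Bxy.
- by move=> x y Bxy; have [] := gP (x, y) Bxy.
- move=> y y' yy'; apply: le_lt_trans (sepY (y, y') yy').
  by rewrite ler_pM2l.
- move=> x y _; apply: le_lt_trans (sep_end (x, y)).
  by rewrite ler_pM2l.
- move=> x y y' s Bxy y'y s01.
  apply: le_lt_trans (sep_arcY ((x, y), y') Bxy y'y s s01).
  by rewrite ler_pM2l.
- move=> x y x' y' s s' Bxy Bx'y' xx' s01 s'01 h h'.
  apply: lt_le_trans delta_eta _.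
  exact: (sep_arcs ((x, y), (x', y')) Bxy Bx'y' xx' s s' s01 s'01 h h').
Qed.

End Planar.

Theorem proposition4p1 (R : realType) (G : sgraph) :
  (0 < #|G|)%N -> zero_map_graph R G ->
  exists (v : G) (A B C : {set G}),
    [/\ clique A, clique B, clique C & neighborhood v = (A :|: B :|: C)%SET].
Proof.
move=> G0 [Y [B [plB hs]]].
exact: (map_graph_tricovered G0 hs (planar_map_dual plB)).
Qed.
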